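(* Suppose the transmitter employs the sparse signalling density $p_X(x)=(1-\tau)\delta(x-x_0)+\tau p_{\tilde X}(x)$ with sparseness factor $\tau$ satisfying $$\tau\le\frac{2\xi\epsilon_{\rm det}}{\sqrt{n\,\chi^2(p_{\tilde W}\parallel p_{W|X=x_0})}},$$ and consider a code with $M$ code words of length $n$, with average decoding error probability not exceeding $\epsilon_{\rm dec}$ and probability of detection not exceeding $\epsilon_{\rm det}$, whose existence is guaranteed with $\log_2 M\ge\epsilon_{\rm det}\sqrt n\,L(\rho)+\frac1\rho\log_2\epsilon_{\rm dec}$ for any $0\le\rho\le1$, where $$L(\rho)=\frac{2\xi}{\log 2}\left(\frac{1+\rho}{\rho}\right)\left(\frac{1-e^{-\frac{1}{1+\rho}\mathcal{E}_0(\rho,p_{\tilde X},p_{Y|X})}}{\sqrt{\chi^2(p_{\tilde W}\parallel p_{W|X=x_0})}}\right).$$ Define the achievable information rate $$R(n)\triangleq\frac1n\log_2 M\ \ge\ \frac{\epsilon_{\rm det}L(\rho)}{\sqrt n}+\frac{1}{n\rho}\log_2\epsilon_{\rm dec}\qquad( * )$$ for any $0\le\rho\le1$. Then $( * )$ is maximised by $$\sqrt{n^*}=\frac{2\log_2\frac{1}{\epsilon_{\rm dec}}}{\epsilon_{\rm det}\,\rho\,L(\rho)},$$ for which $$R(n^* )\ \ge\ \frac{\epsilon_{\rm det}^2}{4\log_2\frac{1}{\epsilon_{\rm dec}}}\,\rho\,L^2(\rho).$$ Moreover, the number of achievable bits that can be sent in $n^*$ channel uses is given by $$k^*=n^*R(n^*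 )=\frac1\rho\log_2\frac{1}{\epsilon_{\rm dec}}.$$
   Context: $\log$ is the natural logarithm, $\delta$ the Dirac delta, $\mathsf{W}_0$ the principal branch of the Lambert W function, $\xi=e^{-\frac12\mathsf{W}_0(4\epsilon_{\rm det}^2)}$, and $\chi^2(p\parallel q)=\int\frac{(p-q)^2}{q}$ is the chi-squared distance. Here $0<\epsilon_{\rm det}<1$ and $\epsilon_{\rm dec}>0$. The receiver channel $p_{Y|X}$ (outputs in $\mathcal{Y}$) and the detector channel $p_{W|X}$ (outputs in $\mathcal{W}$) are memoryless and conditionally independent given the input in $\mathcal{X}$; $x_0\in\mathcal{X}$ is the innocent symbol, i.e. the channel input when no message is sent. $p_{\tilde X}$ is an arbitrary kernel density on $\mathcal{X}$, $0\le\tau\le1$, and $p_{\tilde W}(w)=\int_{\mathcal{X}}p_{\tilde X}(x)p_{W|X}(w|x)\,dx$. Gallager's function is $$\mathcal{E}_0(\rho,p,p_{Y|X})=-\log\int_{\mathcal{Y}}\left\{\int_{\mathcal{X}}p(x)\left[p_{Y|X}(y|x)\right]^{\frac{1}{1+\rho}}dx\right\}^{1+\rho}dy.$$ Setting: code words are generated independently with i.i.d. letters of density $p_X$. Messages are equally likely; message $m$ is sent by transmitting its code word over $n$ uses of $p_{Y|X}$, the receiver knows the code, and a decoding error occurs when the decoded message differs from $m$. The detector does not know the code but knows $p_X$; from $\boldsymbol{w}\in\mathcal{W}^n$ it tests $\mathcal{H}_0$: density $\prod_i p_{W|X}(w_i|x_0)$ (no transmission) against $\mathcal{H}_1$: density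 $\prod_i p_W(w_i)$, where $p_W(w)=\int p_X(x)p_{W|X}(w|x)\,dx$. With $\alpha,\beta$ the false and miss detection probabilities of the test minimising $\alpha+\beta$, ''probability of detection not exceeding $\epsilon_{\rm det}$'' means $\alpha+\beta\ge1-\epsilon_{\rm det}$. It is assumed throughout that $p_W$ is dominated by $p_{W|X=x_0}$ and $p_Y$ (with $p_Y(y)=\int p_X(x)p_{Y|X}(y|x)\,dx$) is dominated by $p_{Y|X=x_0}$, i.e. each vanishes wherever the dominating density vanishes.
   Formalization: Existence is claimed only for τ equal to its bound (so bound ≤ 1), as it fails for smaller τ, e.g. τ=0; ρ=0, where L and n* are undefined, is excluded; k* equals n* times the lower bound in ( * ), and n*R(n* ) ≥ k* for actual codes with n* an integer, since log₂M need not equal k*. *)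

(* Defs.v *)
From HB Require Import structures.
From mathcomp Require Import all_boot all_order all_algebra.
From mathcomp Require Import all_classical all_reals all_analysis.

Set Implicit Arguments.
Unset Strict Implicit.
Unset Printing Implicit Defensive.

Import Order.TTheory GRing.Theory Num.Theory.
Import numFieldNormedType.Exports.

Local Open Scope classical_set_scope.
Local Open Scope ring_scope.

Definition log2 (R : realType) (x : R) : R := ln x / ln 2.

(* The branch with values in [-1, +oo[; for x >= -1/e exactly one such w exists,
   and 0 is returned for x < -1/e. *)
Definition lambertW0 (R : realType) (x : R) : R :=
  xget 0 [set w : R | -1 <= w /\ w * expR w = x].

Definition xi (R : realType) (edet : R) : R :=
  expR (- (2^-1 * lambertW0 (4 * edet ^+ 2))).

(* [I] is integration over one letter, [iter_int I n] integration over words of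
   n letters, as an iterated integral, the first letter being outermost.
   Integrands are nonnegative and measurable and the measures sigma-finite, so
   that this is integration with respect to the n-fold product measure. *)
Fixpoint iter_int (R : realType) (T : Type) (I : (T -> \bar R) -> \bar R)
    (n : nat) : (n.-tuple T -> \bar R) -> \bar R :=
  match n with
  | 0%N => fun f => f [tuple]
  | n'.+1 => fun f =>
      I (fun t => iter_int I (fun s : n'.-tuple T => f [tuple of t :: s]))
  end.

(* [p x y] is the density p(y|x), with respect to the reference measure [mu]
   (written dy); for instance Lebesgue or counting measure. *)
Definition channel (dX dY : measure_display) (X : measurableType dX)
    (Y : measurableType dY) (R : realType) (mu : {measure set Y -> \bar R})
    (p : X -> Y -> R) : Prop :=
  [/\ measurable_fun [set: X * Y] (fun z => p z.1 z.2),
      forall x y, 0 <= p x y &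
      forall x, (\int[mu]_y (p x y)%:E)%E = 1%E].

(* The signalling density (1 - tau) delta(x - x0) + tau p(x), as a measure. *)
Definition sparse (dX : measure_display) (X : measurableType dX) (R : realType)
    (tau : {i01 R}) (x0 : X) (P : {measure set X -> \bar R}) :
    {measure set X -> \bar R} :=
  measure_add (mscale (1 - tau%:num)%:nng (dirac x0)) (mscale tau%:num%:nng P).

(* The output density \int p_X(x) p(y|x) dx. For a channel and a probability
   measure [P] the integral is finite for almost every y; Rintegral puts 0 at
   the exceptional points. *)
Definition output (dX dY : measure_display) (X : measurableType dX)
    (Y : measurableType dY) (R : realType) (P : {measure set X -> \bar R})
    (p : X -> Y -> R) (y : Y) : R :=
  \int[P]_x p x y.

Definition dominated (Y : Type) (R : realType) (p q : Y -> R) : Prop :=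
  forall y, q y = 0 -> p y = 0.

(* Used for [p] dominated by [q] only: where q vanishes so does p, and the
   integrand is 0 / 0 = 0. *)
Definition chi2 (dY : measure_display) (Y : measurableType dY) (R : realType)
    (mu : {measure set Y -> \bar R}) (p q : Y -> R) : \bar R :=
  (\int[mu]_y ((p y - q y) ^+ 2 / q y)%:E)%E.

(* For 0 <= rho, a channel and a probability measure [P], the integral over y
   lies in ]0, 1]. *)
Definition gallagerE0 (dX dY : measure_display) (X : measurableType dX)
    (Y : measurableType dY) (R : realType) (mu : {measure set Y -> \bar R})
    (rho : R) (P : {measure set X -> \bar R}) (p : X -> Y -> R) : R :=
  - ln (fine (\int[mu]_y
      ((\int[P]_x (p x y `^ (1 + rho)^-1)%:E) `^ (1 + rho)))%E).

(* The decoder makes a decision after observing y in Y^n when the codebook is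
   [c]; codebooks are M-tuples of words of length n. *)
Definition decoding_rule (X Y : Type) (n M : nat) : Type :=
  M.-tuple (n.-tuple X) -> n.-tuple Y -> 'I_M.

Definition measurable_rule (dX dY : measure_display) (X : measurableType dX)
    (Y : measurableType dY) (n M : nat) (dec : decoding_rule X Y n M) : Prop :=
  forall m : 'I_M, measurable
    [set z : M.-tuple (n.-tuple X) * n.-tuple Y | dec z.1 z.2 = m].

(* Decoding error probability of the fixed codebook [c], for equally likely
   messages. *)
Definition codebook_error (dX dY : measure_display) (X : measurableType dX)
    (Y : measurableType dY) (R : realType) (mu : {measure set Y -> \bar R})
    (p : X -> Y -> R) (n M : nat) (dec : decoding_rule X Y n M)
    (c : M.-tuple (n.-tuple X)) : \bar R :=
  ((M%:R^-1)%:E * \sum_(m < M)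
    iter_int (fun f => \int[mu]_y f y) (fun y : n.-tuple Y =>
      ((dec c y != m)%:R *
       \prod_(i < n) p (tnth (tnth c m) i) (tnth y i))%:E))%E.

(* Average of the above over the choice of the codebook: M independent words
   of n i.i.d. letters of law [PX]. *)
Definition average_error (dX dY : measure_display) (X : measurableType dX)
    (Y : measurableType dY) (R : realType) (mu : {measure set Y -> \bar R})
    (p : X -> Y -> R) (PX : {measure set X -> \bar R}) (n M : nat)
    (dec : decoding_rule X Y n M) : \bar R :=
  iter_int (fun f => iter_int (fun g => \int[PX]_x g x)%E f)
    (fun c : M.-tuple (n.-tuple X) => codebook_error mu p dec c).

(* A test is given by the set [A] of words for which a transmission is
   declared; [q0] and [q1] are the densities of a letter under H0 and H1.
   The value is the sum of the false and miss detection probabilities. *)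
Definition test_error (dW : measure_display) (W : measurableType dW)
    (R : realType) (mu : {measure set W -> \bar R}) (q0 q1 : W -> R) (n : nat)
    (A : set (n.-tuple W)) : \bar R :=
  (iter_int (fun f => \int[mu]_w f w) (fun w : n.-tuple W =>
     (\1_A w * \prod_(i < n) q0 (tnth w i))%:E) +
   iter_int (fun f => \int[mu]_w f w) (fun w : n.-tuple W =>
     (\1_(~` A) w * \prod_(i < n) q1 (tnth w i))%:E))%E.

Definition optimal_test (dW : measure_display) (W : measurableType dW)
    (R : realType) (mu : {measure set W -> \bar R}) (q0 q1 : W -> R) (n : nat)
    (A : set (n.-tuple W)) : Prop :=
  measurable A /\ forall B : set (n.-tuple W), measurable B ->
    (test_error mu q0 q1 A <= test_error mu q0 q1 B)%E.

Definition detection_le (dW : measure_display) (W : measurableType dW)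
    (R : realType) (mu : {measure set W -> \bar R}) (q0 q1 : W -> R) (n : nat)
    (edet : R) : Prop :=
  exists2 A : set (n.-tuple W), optimal_test mu q0 q1 A &
    ((1 - edet)%:E <= test_error mu q0 q1 A)%E.

(* A random code of M words of length n with letters of law [PX], revealed to
   the receiver through [dec] but not to the detector. *)
Definition covert_code (dX dY dW : measure_display) (X : measurableType dX)
    (Y : measurableType dY) (W : measurableType dW) (R : realType)
    (muY : {measure set Y -> \bar R}) (muW : {measure set W -> \bar R})
    (pYX : X -> Y -> R) (pWX : X -> W -> R) (x0 : X) (edet edec : R)
    (PX : {measure set X -> \bar R}) (n M : nat)
    (dec : decoding_rule X Y n M) : Prop :=
  [/\ measurable_rule dec,
      (average_error muY pYX PX dec <= edec%:E)%E &
      detection_le muW (pWX x0) (output PX pWX) n edet].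

(* When the chi-squared distance is infinite, [fine] and division by zero give
   the value 0, which is the intended one. *)
Definition tau_max (dX dW : measure_display) (X : measurableType dX)
    (W : measurableType dW) (R : realType) (muW : {measure set W -> \bar R})
    (pWX : X -> W -> R) (x0 : X) (Pt : {measure set X -> \bar R}) (edet : R)
    (n : nat) : R :=
  2 * xi edet * edet /
    Num.sqrt (n%:R * fine (chi2 muW (output Pt pWX) (pWX x0))).

(* The quantity L(rho). *)
Definition gain (dX dY dW : measure_display) (X : measurableType dX)
    (Y : measurableType dY) (W : measurableType dW) (R : realType)
    (muY : {measure set Y -> \bar R}) (muW : {measure set W -> \bar R})
    (pYX : X -> Y -> R) (pWX : X -> W -> R) (x0 : X)
    (Pt : {measure set X -> \bar R}) (edet rho : R) : R :=
  2 * xi edet / ln 2 * ((1 + rho) / rho) *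
  ((1 - expR (- ((1 + rho)^-1 * gallagerE0 muY rho Pt pYX))) /
   Num.sqrt (fine (chi2 muW (output Pt pWX) (pWX x0)))).

(* Information rate, in bits per channel use. *)
Definition rate (R : realType) (n M : nat) : R := n%:R^-1 * log2 M%:R.

(* The guaranteed rate, as a function of a real blocklength [t]; [l] is the
   value of L(rho). *)
Definition rate_bound (R : realType) (edet edec rho l t : R) : R :=
  edet * l / Num.sqrt t + (t * rho)^-1 * log2 edec.

(* Main.v *)
(* Covertness: the total variation between the n-fold output laws is at most
   half the square root of their chi-squared distance (1 + tau^2 chi2)^n - 1, and
   the choice of xi in terms of the Lambert function makes this at most
   4 edet^2 when tau^2 chi2 = 4 xi^2 edet^2 / n.
   Reliability: with i.i.d. code words and maximum likelihood decoding the error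
   probability is at most (M - 1)^rho exp(- n E_0(rho, p_X)), and convexity of
   the L^(1 + rho) norm gives
   E_0(rho, p_X) >= (1 + rho) tau (1 - exp(- E_0(rho, p_Xt) / (1 + rho))).
   The least M with log2 M above the claimed bound therefore works.
   The guaranteed rate is a concave quadratic polynomial in 1 / sqrt n.
   Jensen, Hoelder and Cauchy-Schwarz all enter in linearised form (a tangent
   line at a point chosen afterwards), so that only integrals of products over
   the letters are ever computed. *)

Require Import Defs.
From HB Require Import structures.
From mathcomp Require Import all_boot all_order all_algebra.
From mathcomp Require Import all_classical all_reals all_analysis.
From mathcomp Require Import ring lra.
Import Order.TTheory GRing.Theory Num.Theory.
Import numFieldNormedType.Exports.
Import measurable_realfun.
Local Open Scope classical_set_scope.
Local Open Scope ring_scope.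

Set Implicit Arguments.
Unset Strict Implicit.
Unset Printing Implicit Defensive.

(** * Iterated integrals *)

(** Since [iter_int] accepts any functional of this kind, the notion can be applied twice: to words
    of letters, then to codebooks of words. *)
Definition integrates {d} {T : measurableType d} {R : realType}
    (I : (T -> \bar R) -> \bar R) (mu : {measure set T -> \bar R}) : Prop :=
  forall f : T -> \bar R, measurable_fun [set: T] f -> (forall x, 0 <= f x)%E ->
    I f = (\int[mu]_x f x)%E.

Section measure_upgrade.
Context d (T : measurableType d) (R : realType).
Implicit Type mu : {measure set T -> \bar R}.

(* The proof argument makes these constants keys for canonical instances. *)
Definition as_sigma_finite mu (_ : sigma_finite [set: T] mu) : set T -> \bar R := mu.
Definition as_probability mu (_ : mu [set: T] = 1%E) : set T -> \bar R := mu.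

HB.instance Definition _ mu h := Measure.on (@as_sigma_finite mu h).
HB.instance Definition _ mu h :=
  @Measure_isSigmaFinite.Build _ _ _ (@as_sigma_finite mu h) h.

HB.instance Definition _ mu h := Measure.on (@as_probability mu h).
HB.instance Definition _ mu h :=
  @Measure_isProbability.Build _ _ _ (@as_probability mu h) h.

Lemma sigma_finite_measure_exists mu : sigma_finite [set: T] mu ->
  exists nu : {sigma_finite_measure set T -> \bar R}, forall A, nu A = mu A.
Proof. by move=> mufin; exists (as_sigma_finite mufin). Qed.

Lemma probability_exists mu : mu [set: T] = 1%E ->
  exists P : probability T R, forall A, P A = mu A.
Proof. by move=> mu1; exists (as_probability mu1). Qed.

End measure_upgrade.

Lemma emeasurable_prod d (T : measurableType d) (R : realType) (J : Type)
    (s : seq J) (h : J -> T -> \bar R) :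
  (forall j, measurable_fun [set: T] (h j)) ->
  measurable_fun [set: T] (fun x => \prod_(j <- s) h j x)%E.
Proof.
move=> mh; elim: s => [|j s ih].
  by under eq_fun do rewrite big_nil; exact: measurable_cst.
by under eq_fun do rewrite big_cons; apply: emeasurable_funM.
Qed.

Section iterated_integral.
Context d (T : measurableType d) (R : realType).
Implicit Types (I : (T -> \bar R) -> \bar R) (n : nat).

Lemma measurable_tcons n :
  measurable_fun [set: T * n.-tuple T] (fun z => [tuple of z.1 :: z.2]).
Proof. exact: (@measurable_cons _ _ _ _ fst n snd). Qed.

(** By induction, [mu \x nu] is pushed forward along consing, and Tonelli's theorem turns its
    integral into the iterated one. *)
Lemma iter_int_measure I (mu : {sigma_finite_measure set T -> \bar R}) n :
  integrates I mu ->
  exists nu : {sigma_finite_measure set (n.-tuple T) -> \bar R},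
    integrates (iter_int I (n := n)) nu.
Proof.
move=> Imu; elim: n => [|n [nu IH]].
  exists (@dirac _ (0.-tuple T) [tuple] R) => f mf f0 /=.
  by rewrite integral_dirac// diracT mul1e.
pose cons (z : T * n.-tuple T) := [tuple of z.1 :: z.2].
pose uncons (s : n.+1.-tuple T) := (thead s, [tuple of behead s]).
have mcons : measurable_fun [set: T * n.-tuple T] cons by exact: measurable_tcons.
have muncons : measurable_fun [set: n.+1.-tuple T] uncons.
  apply: measurable_fun_pair; first exact: measurable_tnth.
  exact: measurable_behead.
have [lam lamE] : exists lam : {measure set (n.+1.-tuple T) -> \bar R},
    forall A, lam A = pushforward (mu \x nu)%E cons A.
  by exists (measure_function_pushforward__canonical__measure_function_Measure
              (mu \x nu)%E mcons).
(* Push-forwards need not be sigma-finite; here consing has the inverse [uncons], which carries the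
   covering rectangles over to tuples. *)
have [lam' lam'E] : exists nu : {sigma_finite_measure set (n.+1.-tuple T) -> \bar R},
    forall A, nu A = lam A.
  apply: sigma_finite_measure_exists.
  have /sigma_finiteP[F [UF ndF Ffin]] := sigma_finiteT mu.
  have /sigma_finiteP[G [UG ndG Gfin]] := sigma_finiteT nu.
  have consK : cancel cons uncons.
    by case=> t s; rewrite /uncons /cons /= theadE; congr (_, _); apply/val_inj.
  have mFG k : measurable (F k `*` G k).
    by apply: measurableX; [exact: (Ffin k).1|exact: (Gfin k).1].
  exists (fun k => uncons @^-1` (F k `*` G k)).
    rewrite -preimage_bigcup (_ : \bigcup_k _ = setT) ?preimage_setT//.
    apply/seteqP; split => // -[t s] _.
    have [i _ Fi] : (\bigcup_i F i) t by rewrite -UF.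
    have [j _ Gj] : (\bigcup_j G j) s by rewrite -UG.
    exists (maxn i j) => //; split => /=.
    - by move: Fi; apply/subsetPset/ndF/leq_maxl.
    - by move: Gj; apply/subsetPset/ndG/leq_maxr.
  move=> k; split.
    by rewrite -[X in measurable X]setTI; apply: muncons.
  rewrite lamE /pushforward -comp_preimage (_ : uncons \o cons = id) ?preimage_id.
    rewrite product_measure1E; [|exact: (Ffin k).1|exact: (Gfin k).1].
    by rewrite lte_mul_pinfty ?ge0_fin_numE ?(Ffin k).2 ?(Gfin k).2.
  by apply/funext => z /=; rewrite consK.
exists lam' => f mf f0 /=.
have mfc : measurable_fun [set: T * n.-tuple T] (f \o cons).
  exact: measurableT_comp.
rewrite (@eq_measure_integral _ _ _ _ lam); last by move=> A _ _; exact: lam'E.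
rewrite (_ : Measure.sort lam = pushforward (mu \x nu)%E cons); last exact/funext.
rewrite ge0_integral_pushforward// preimage_setT fubini_tonelli1//; last first.
  by move=> z; exact: f0.
transitivity (I (fubini_F nu (f \o cons))).
  congr I; apply/funext => t; rewrite (IH _ _ (fun=> f0 _))//.
  by apply: measurableT_comp => //; exact: measurable_cons.
apply: Imu.
- by apply: measurable_fun_fubini_tonelli_F => // z; exact: f0.
- by move=> x; apply: integral_ge0 => s _; exact: f0.
Qed.

(** The factor of the first letter is a constant for the inner functional, which [iter_int_measure]
    identifies with an integral, so that the constant can be pulled out. *)
Lemma iter_int_prod I (mu : {sigma_finite_measure set T -> \bar R}) n
    (h : 'I_n -> T -> \bar R) :
  integrates I mu -> (forall i, measurable_fun [set: T] (h i)) ->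
  (forall i x, 0 <= h i x)%E ->
  iter_int I (fun s : n.-tuple T => \prod_(i < n) h i (tnth s i))%E =
  (\prod_(i < n) \int[mu]_x h i x)%E.
Proof.
move=> Imu; elim: n h => [|n IH] h mh h0 /=; first by rewrite !big_ord0.
have prod_ge0 (s : n.-tuple T) : (0 <= \prod_(i < n) h (lift ord0 i) (tnth s i))%E.
  by apply: prode_ge0.
transitivity (I (fun t => h ord0 t * \prod_(i < n) \int[mu]_x h (lift ord0 i) x)%E).
  congr I; apply/funext => t.
  rewrite -IH//; have [nu nuE] := iter_int_measure n Imu.
  have mprod : measurable_fun [set: n.-tuple T]
      (fun s => \prod_(i < n) h (lift ord0 i) (tnth s i))%E.
    apply: emeasurable_prod => i; apply: measurableT_comp => //.
    exact: measurable_tnth.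
  rewrite !nuE//; last 2 first.
  - apply: emeasurable_prod => i; apply: measurableT_comp => //.
    apply: (measurableT_comp (measurable_tnth i)).
    exact: measurable_cons.
  - by move=> s; apply: prode_ge0.
  rewrite -ge0_integralZl//; apply: eq_integral => s _.
  rewrite big_ord_recl tnth0; congr (_ * _)%E.
  by apply: eq_bigr => i _; rewrite tnthS.
have c0 : (0 <= \prod_(i < n) \int[mu]_x h (lift ord0 i) x)%E.
  by apply: prode_ge0 => i _; apply: integral_ge0.
rewrite Imu; last 2 first.
- by apply: emeasurable_funM.
- by move=> t; exact: mule_ge0.
rewrite big_ord_recl muleC -ge0_integralZl//.
by apply: eq_integral => t _; rewrite muleC.
Qed.
End iterated_integral.

(** * Detection *)

(** The intermediate value theorem on [0, x] gives a solution, as w exp w vanishes at 0 and is at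
    least x at x. Being nonnegative it meets the branch condition, so [xget] does not fall back on
    its default. *)
Lemma lambertW0P (R : realType) (x : R) : 0 <= x ->
  lambertW0 x * expR (lambertW0 x) = x.
Proof.
move=> x0.
have cont : {within `[0, x], continuous (fun w : R => w * expR w)}.
  apply: continuous_subspaceT => w.
  by apply: cvgM; [exact: cvg_id|exact: continuous_expR].
have [w wx wE] : exists2 w, w \in `[0, x] & w * expR w = x.
  apply: IVT => //; rewrite expR0 mulr1 ge_min le_max x0 /=.
  by rewrite ler_peMr ?orbT// -expR0 ler_expR.
pose P := [set w : R | -1 <= w /\ w * expR w = x].
suff [] : P (xget 0 P) by [].
apply: (@xgetI _ _ _ w).
by split=> //; apply: (@le_trans _ _ 0); rewrite ?lerN10 ?(itvP wx).
Qed.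

(** With w = W_0(4 e^2), the square of xi is exp(-w), so the exponent on the left is w and the claim
    reads exp w <= 1 + w exp w, that is 1 - w <= exp(-w). *)
Lemma expR_xi_le (R : realType) (e : R) : 0 < e ->
  expR (4 * xi e ^+ 2 * e ^+ 2) <= 1 + 4 * e ^+ 2.
Proof.
move=> e0; rewrite /xi; set w := lambertW0 _.
have wE : w * expR w = 4 * e ^+ 2 by apply: lambertW0P; rewrite mulr_ge0 ?sqr_ge0.
have -> : expR (- (2^-1 * w)) ^+ 2 = expR (- w).
  by rewrite -expRM_natl; congr expR; lra.
rewrite mulrAC -wE expRN mulfK ?expR_eq0//.
have := expR_ge1Dx (- w); rewrite expRN -(ler_pM2l (expR_gt0 w)) divff ?expR_eq0//.
lra.
Qed.

(* The slack is [(t - 1 -+ 2 e)^2 / (8 e)] with [t = b / a]; integrated, this is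
   the bound of the total variation by half the square root of the chi-squared
   distance. *)
Lemma error_tangent (R : realType) (e a b c : R) :
  0 < e -> 0 <= a -> (a = 0 -> b = 0) -> (c = a \/ c = b) ->
  a * 2^-1 + b * (2^-1 + (4 * e)^-1) <=
  c + (b ^+ 2 / a * (8 * e)^-1 + a * ((8 * e)^-1 + e / 2)).
Proof.
move=> e0; rewrite le_eqVlt => /predU1P[<-|a0] ab ca.
  by have b0 := ab erefl; rewrite b0 in ca *; case: ca => ->; lra.
pose t := b / a; have bE : b = t * a by rewrite /t divfK ?gt_eqF.
have -> : b ^+ 2 / a = t ^+ 2 * a by rewrite bE; field; rewrite gt_eqF.
have slack (s : R) : a * ((t - 1 + s) ^+ 2 / (8 * e)) >= 0.
  by rewrite mulr_ge0 ?divr_ge0 ?sqr_ge0 ?ltW// mulr_gt0.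
case: ca => ->; rewrite -subr_ge0; [have := slack (- (2 * e))|have := slack (2 * e)];
  move=> /le_trans; apply; rewrite le_eqVlt bE; apply/orP; left; apply/eqP; field;
  exact: lt0r_neq0.
Qed.

Lemma measurable_fun_div_ge0 d (T : measurableType d) (R : realType)
    (f g : T -> R) :
  measurable_fun [set: T] f -> measurable_fun [set: T] g ->
  (forall x, 0 <= g x) -> measurable_fun [set: T] (fun x => f x / g x).
Proof.
move=> mf mg g0; under eq_fun do rewrite -powR_inv1//.
apply: measurable_funM => //.
exact: (measurableT_comp (measurable_powR (-1)) mg).
Qed.

Section word_densities.
Context d (T : measurableType d) (R : realType).
Variable mu : {sigma_finite_measure set T -> \bar R}.
Variable n : nat.

Let I (f : T -> \bar R) : \bar R := (\int[mu]_x f x)%E.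

Lemma integrates_self (nu : {measure set T -> \bar R}) :
  integrates (fun f => \int[nu]_x f x)%E nu.
Proof. by []. Qed.

Lemma measurable_word_prod (h : T -> R) : measurable_fun [set: T] h ->
  measurable_fun [set: n.-tuple T] (fun s => \prod_(i < n) h (tnth s i)).
Proof.
move=> mh; apply: measurable_prod => i _.
by apply: measurableT_comp => //; exact: measurable_tnth.
Qed.

Lemma integral_word_prod (nu : {measure set (n.-tuple T) -> \bar R})
    (h : T -> R) (c : R) :
  integrates (iter_int I (n := n)) nu ->
  measurable_fun [set: T] h -> (forall x, 0 <= h x) ->
  (\int[mu]_x (h x)%:E)%E = c%:E ->
  (\int[nu]_s (\prod_(i < n) h (tnth s i))%:E)%E = (c ^+ n)%:E.
Proof.
move=> Inu mh h0 hc; rewrite -Inu; last 2 first.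
- by apply/measurable_EFinP; exact: measurable_word_prod.
- by move=> s; rewrite lee_fin prodr_ge0.
under [X in iter_int _ X]eq_fun do rewrite -prodEFin.
rewrite (@iter_int_prod _ _ _ I mu n (fun=> EFin \o h))//=; last first.
  by move=> _; by apply/measurable_EFinP.
under eq_bigr do rewrite hc.
by rewrite prodEFin prodr_const card_ord.
Qed.

End word_densities.

(** [S] is the second moment of the likelihood ratio of one letter, so S^n is that of a word. With k
    = 1 / (8 e), integrating [error_tangent] for the two word densities bounds the error below by 1
    + 2 k - (S^n k + k + e / 2), which is at least 1 - e when S^n <= 1 + 4 e^2. *)
Lemma detection_bound d (W : measurableType d) (R : realType)
    (mu : {sigma_finite_measure set W -> \bar R}) (q0 q1 : W -> R) (n : nat)
    (e S : R) :
  0 < e ->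
  measurable_fun [set: W] q0 -> measurable_fun [set: W] q1 ->
  (forall w, 0 <= q0 w) -> (forall w, 0 <= q1 w) ->
  (\int[mu]_w (q0 w)%:E)%E = 1%E -> (\int[mu]_w (q1 w)%:E)%E = 1%E ->
  dominated q1 q0 ->
  (\int[mu]_w (q1 w ^+ 2 / q0 w)%:E)%E = S%:E ->
  S ^+ n <= 1 + 4 * e ^+ 2 ->
  detection_le mu q0 q1 n e.
Proof.
move=> e0 mq0 mq1 q0_ge0 q1_ge0 q0_1 q1_1 dom chiS Sn.
have [nu Inu] := iter_int_measure n (integrates_self mu).
pose Q0 (w : n.-tuple W) := \prod_(i < n) q0 (tnth w i).
pose Q1 (w : n.-tuple W) := \prod_(i < n) q1 (tnth w i).
have mQ0 : measurable_fun [set: n.-tuple W] Q0 by exact: measurable_word_prod.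
have mQ1 : measurable_fun [set: n.-tuple W] Q1 by exact: measurable_word_prod.
have Q0_ge0 w : 0 <= Q0 w by exact: prodr_ge0.
have Q1_ge0 w : 0 <= Q1 w by exact: prodr_ge0.
pose err (A : set (n.-tuple W)) w : R := \1_A w * Q0 w + \1_(~` A) w * Q1 w.
have mind (A : set (n.-tuple W)) : measurable A ->
    measurable_fun [set: n.-tuple W] (\1_A : _ -> R).
  by move=> mA; exact: measurable_indic.
have merr A : measurable A -> measurable_fun [set: n.-tuple W] (err A).
  move=> mA; apply: measurable_funD; apply: measurable_funM => //; apply: mind => //.
  exact: measurableC.
have err_ge0 A w : 0 <= err A w by rewrite addr_ge0// mulr_ge0.
have errE A : measurable A -> test_error mu q0 q1 A = (\int[nu]_w (err A w)%:E)%E.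
  move=> mA.
  have m0 : measurable_fun [set: n.-tuple W] (fun w => (\1_A w * Q0 w)%:E).
    by apply/measurable_EFinP; apply: measurable_funM => //; exact: mind.
  have m1 : measurable_fun [set: n.-tuple W] (fun w => (\1_(~` A) w * Q1 w)%:E).
    apply/measurable_EFinP; apply: measurable_funM => //; apply: mind.
    exact: measurableC.
  have g0 w : (0 <= (\1_A w * Q0 w)%:E)%E by rewrite lee_fin mulr_ge0.
  have g1 w : (0 <= (\1_(~` A) w * Q1 w)%:E)%E by rewrite lee_fin mulr_ge0.
  by rewrite /test_error !Inu// -ge0_integralD.
(* The likelihood ratio test: its error integrand is the minimum of the two word densities, so it is
   optimal already pointwise. *)
pose A := [set w | Q0 w < Q1 w].
have mA : measurable A.
  rewrite -[A]setTI.
  exact: (measurable_fun_ltr mQ0 mQ1 measurableT (Y := [set true])).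
have errmin B w : err A w <= err B w.
  rewrite /err !indicE !in_setC /= /A.
  rewrite (_ : (w \in [set w | Q0 w < Q1 w]) = (Q0 w < Q1 w)); last first.
    by apply/idP/idP; rewrite inE.
  by case: ltP; case: (w \in B); rewrite /= ?mul1r ?mul0r ?addr0 ?add0r// => /ltW.
exists A.
  split=> // B mB; rewrite !errE//; apply: ge0_le_integral => //.
  - by move=> w _; rewrite lee_fin.
  - by apply/measurable_EFinP; exact: merr.
  - by apply/measurable_EFinP; exact: merr.
  - by move=> w _; rewrite lee_fin.
rewrite errE//.
have Q0_1 : (\int[nu]_w (Q0 w)%:E)%E = 1%E.
  by rewrite (integral_word_prod (c := 1) Inu mq0 q0_ge0 q0_1) /= expr1n.
have Q1_1 : (\int[nu]_w (Q1 w)%:E)%E = 1%E.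
  by rewrite (integral_word_prod (c := 1) Inu mq1 q1_ge0 q1_1) /= expr1n.
have mchi : measurable_fun [set: W] (fun w => q1 w ^+ 2 / q0 w).
  by apply: measurable_fun_div_ge0 => //; exact: measurable_funX.
have chi_ge0 w : 0 <= q1 w ^+ 2 / q0 w by rewrite divr_ge0 ?sqr_ge0.
have QS : (\int[nu]_w (Q1 w ^+ 2 / Q0 w)%:E)%E = (S ^+ n)%:E.
  rewrite -(integral_word_prod Inu mchi chi_ge0 chiS); apply: eq_integral => w _.
  by rewrite prodf_div -prodrXl.
have mchiQ : measurable_fun [set: n.-tuple W] (fun w => Q1 w ^+ 2 / Q0 w).
  by apply: measurable_fun_div_ge0 => //; exact: measurable_funX.
have chiQ_ge0 w : 0 <= Q1 w ^+ 2 / Q0 w by rewrite divr_ge0 ?sqr_ge0.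
pose k := (8 * e)^-1.
have k_ge0 : 0 <= k by rewrite invr_ge0 mulr_ge0 ?ltW.
pose l := 2^-1 + (4 * e)^-1.
have l_ge0 : 0 <= l by rewrite addr_ge0 ?invr_ge0// mulr_ge0 ?ltW.
have intZ (f : n.-tuple W -> R) (c : R) : measurable_fun [set: n.-tuple W] f ->
    (forall w, 0 <= f w) -> 0 <= c ->
    (\int[nu]_w (f w * c)%:E = (\int[nu]_w (f w)%:E) * c%:E)%E.
  move=> mf f0 c0; under eq_integral do rewrite mulrC EFinM.
  rewrite ge0_integralZl// ?lee_fin//.
  - by rewrite muleC.
  - by apply/measurable_EFinP.
  - by move=> w _; rewrite lee_fin.
have intD (f g : n.-tuple W -> R) : measurable_fun [set: n.-tuple W] f ->
    measurable_fun [set: n.-tuple W] g ->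
    (forall w, 0 <= f w) -> (forall w, 0 <= g w) ->
    (\int[nu]_w (f w + g w)%:E =
     \int[nu]_w (f w)%:E + \int[nu]_w (g w)%:E)%E.
  move=> mf mg f0 g0; under eq_integral do rewrite EFinD.
  rewrite ge0_integralD//.
  - by move=> w _; rewrite lee_fin.
  - by apply/measurable_EFinP.
  - by move=> w _; rewrite lee_fin.
  - by apply/measurable_EFinP.
have mM (f : n.-tuple W -> R) (c : R) : measurable_fun [set: n.-tuple W] f ->
    measurable_fun [set: n.-tuple W] (fun w => f w * c).
  by move=> mf; exact: (measurable_funM mf (measurable_cst c)).
have gM (f : n.-tuple W -> R) (c : R) : (forall w, 0 <= f w) -> 0 <= c ->
    forall w, 0 <= f w * c.
  by move=> f0 c0 w; rewrite mulr_ge0.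
have h_ge0 : 0 <= 2^-1 :> R by rewrite invr_ge0.
have ke_ge0 : 0 <= k + e / 2 by rewrite addr_ge0// divr_ge0 ?ltW.
have mR := measurable_funD (mM _ k mchiQ) (mM _ (k + e / 2) mQ0).
have R_ge0 w : 0 <= Q1 w ^+ 2 / Q0 w * k + Q0 w * (k + e / 2).
  by apply: addr_ge0; apply: mulr_ge0.
(* All terms are kept nonnegative on both sides, so that the integrals split without any
   integrability condition. *)
have main : (\int[nu]_w (Q0 w * 2^-1 + Q1 w * l)%:E <=
    \int[nu]_w (err A w + (Q1 w ^+ 2 / Q0 w * k + Q0 w * (k + e / 2)))%:E)%E.
  apply: ge0_le_integral => //.
  - by move=> w _; rewrite lee_fin; apply: addr_ge0; apply: mulr_ge0.
  - apply/measurable_EFinP.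
    exact: (measurable_funD (mM _ 2^-1 mQ0) (mM _ l mQ1)).
  - by apply/measurable_EFinP; exact: (measurable_funD (merr _ mA) mR).
  - move=> w _; rewrite lee_fin; apply: error_tangent => //.
      (* Domination passes to words: a vanishing product has a vanishing factor. *)
      move=> /eqP; rewrite prodf_seq_eq0 => /hasP[i _ /= /eqP /dom q1i].
      by rewrite /Q1 (bigD1 i)//= q1i mul0r.
    rewrite /err !indicE in_setC; case: (w \in A); [left|right];
      by rewrite /= ?mul1r ?mul0r ?addr0 ?add0r.
move: main.
rewrite (intD _ _ (mM _ _ mQ0) (mM _ _ mQ1) (gM _ _ Q0_ge0 h_ge0) (gM _ _ Q1_ge0 l_ge0)).
rewrite (intD _ _ (merr _ mA) mR (err_ge0 A) R_ge0).
rewrite (intD _ _ (mM _ _ mchiQ) (mM _ _ mQ0) (gM _ _ chiQ_ge0 k_ge0) (gM _ _ Q0_ge0 ke_ge0)).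
rewrite (intZ _ _ mQ0 Q0_ge0 h_ge0) (intZ _ _ mQ1 Q1_ge0 l_ge0).
rewrite (intZ _ _ mchiQ chiQ_ge0 k_ge0) (intZ _ _ mQ0 Q0_ge0 ke_ge0).
rewrite Q0_1 Q1_1 QS !mul1e.
have : (0 <= \int[nu]_w (err A w)%:E)%E by apply: integral_ge0 => w _; rewrite lee_fin; exact: err_ge0.
case: (\int[nu]_w (err A w)%:E)%E => [r| |]//=; last by move=> _ _; rewrite leey.
rewrite !lee_fin => _.
have : S ^+ n * k <= (1 + 4 * e ^+ 2) * k by rewrite ler_wpM2r.
have kl : 2^-1 + l = 1 + 2 * k by rewrite /l /k; field; exact: lt0r_neq0.
have ek : 4 * e ^+ 2 * k = e / 2 by rewrite /k; field; exact: lt0r_neq0.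
lra.
Qed.

(** * Sparse signalling densities *)

Section output_density.
Context dX dY (X : measurableType dX) (Y : measurableType dY) (R : realType).
Variables (mu : {sigma_finite_measure set Y -> \bar R}) (p : X -> Y -> R).
Hypothesis chp : channel mu p.

Lemma measurable_channel_kernel (x : X) : measurable_fun [set: Y] (p x).
Proof. by case: chp => mp _ _; exact: (measurable_fun_pair2 x mp). Qed.

Lemma measurable_channel_density (y : Y) : measurable_fun [set: X] (p^~ y).
Proof. by case: chp => mp _ _; exact: (measurable_fun_pair1 y mp). Qed.

Lemma output_ge0 (P : {measure set X -> \bar R}) y : 0 <= output P p y.
Proof.
by case: chp => _ p0 _; apply: fine_ge0; apply: integral_ge0 => x _; rewrite lee_fin.
Qed.

Variable P : probability X R.

Lemma measurable_mixture :
  measurable_fun [set: Y] (fun y => \int[P]_x (p x y)%:E)%E.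
Proof.
case: chp => mp p0 _.
have mpE : measurable_fun [set: X * Y] (fun z => (p z.1 z.2)%:E).
  by apply/measurable_EFinP.
exact: (measurable_fun_fubini_tonelli_G (m1 := P) _ mpE (fun z => p0 z.1 z.2)).
Qed.

Lemma integral_mixture : (\int[mu]_y \int[P]_x (p x y)%:E)%E = 1%E.
Proof.
case: chp => mp p0 p1.
have mpE : measurable_fun [set: X * Y] (fun z => (p z.1 z.2)%:E).
  by apply/measurable_EFinP.
transitivity (\int[P]_x \int[mu]_y (p x y)%:E)%E.
  exact/esym/(fubini_tonelli (m1 := P) (m2 := mu) _ mpE (fun z => p0 z.1 z.2)).
rewrite (_ : (fun x => _) = cst 1%E); last exact/funext.
by rewrite integral_cst// mul1e; exact: probability_setT.
Qed.

Lemma measurable_output : measurable_fun [set: Y] (output P p).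
Proof. exact: (measurableT_comp (@fine_measurable R _ measurableT) measurable_mixture). Qed.

(** The extended real mixture has integral 1, hence is finite almost everywhere, and there the
    truncation made by [Rintegral] changes nothing. *)
Lemma ae_output :
  \forall y \ae mu, (output P p y)%:E = (\int[P]_x (p x y)%:E)%E.
Proof.
have : mu.-integrable [set: Y] (fun y => \int[P]_x (p x y)%:E)%E.
  apply/integrableP; split; first exact: measurable_mixture.
  under eq_integral => y _.
    rewrite gee0_abs; last first.
      by apply: integral_ge0 => x _; rewrite lee_fin; case: chp.
    over.
  by rewrite integral_mixture ltry.
move=> /(integrable_ae measurableT); apply: filterS => y /(_ I) yfin.
by rewrite /output /Rintegral fineK.
Qed.

Lemma integral_output : (\int[mu]_y (output P p y)%:E)%E = 1%E.
Proof.
rewrite -integral_mixture; apply: ge0_ae_eq_integral => //.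
- by apply/measurable_EFinP; exact: measurable_output.
- exact: measurable_mixture.
- by move=> y _; rewrite lee_fin output_ge0.
- by move=> y _; apply: integral_ge0 => x _; rewrite lee_fin; case: chp.
- by apply: filterS ae_output => y yE _.
Qed.

End output_density.

Lemma integral_sparse d (X : measurableType d) (R : realType) (tau : {i01 R})
    (x0 : X) (Pt : {measure set X -> \bar R}) (f : X -> \bar R) :
  measurable_fun [set: X] f -> (forall x, 0 <= f x)%E ->
  (\int[sparse tau x0 Pt]_x f x =
   (1 - tau%:num)%:E * f x0 + tau%:num%:E * \int[Pt]_x f x)%E.
Proof.
move=> mf f0; rewrite ge0_integral_measure_add//.
by rewrite !ge0_integral_mscale//= integral_dirac// diracT mul1e.
Qed.

Lemma sparse_probability d (X : measurableType d) (R : realType) (tau : {i01 R})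
    (x0 : X) (Pt : probability X R) :
  exists P : probability X R, sparse tau x0 Pt = P.
Proof.
have [|P PE] := @probability_exists _ _ _ (sparse tau x0 Pt); last first.
  by exists P; apply: eq_measure; apply/funext => A; exact/esym/PE.
rewrite -[LHS]mul1e -integral_cst// integral_sparse//=.
have Pt1 : (Pt : {measure set X -> \bar R}) [set: X] = 1%E := probability_setT Pt.
by rewrite integral_cst// Pt1 !mule1 -EFinD subrK.
Qed.

(** Expanding the square gives q1^2 / q0 + q0 = (q1 - q0)^2 / q0 + 2 q1, by domination also where q0
    vanishes. In this form it integrates without subtracting possibly infinite integrals. *)
Lemma integral_chi2 d (W : measurableType d) (R : realType)
    (mu : {measure set W -> \bar R}) (q0 q1 : W -> R) (c : R) :
  measurable_fun [set: W] q0 -> measurable_fun [set: W] q1 ->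
  (forall w, 0 <= q0 w) -> (forall w, 0 <= q1 w) ->
  (\int[mu]_w (q0 w)%:E)%E = 1%E -> (\int[mu]_w (q1 w)%:E)%E = 1%E ->
  dominated q1 q0 -> chi2 mu q1 q0 = c%:E ->
  (\int[mu]_w (q1 w ^+ 2 / q0 w)%:E)%E = (1 + c)%:E.
Proof.
move=> mq0 mq1 q0_ge0 q1_ge0 q0_1 q1_1 dom chic.
have m1 : measurable_fun [set: W] (fun w => q1 w ^+ 2 / q0 w).
  by apply: measurable_fun_div_ge0 => //; exact: measurable_funX.
have m2 : measurable_fun [set: W] (fun w => (q1 w - q0 w) ^+ 2 / q0 w).
  apply: measurable_fun_div_ge0 => //; apply: measurable_funX.
  exact: measurable_funB.
have square_ge0 (r : W -> R) w : [set: W] w -> (0 <= (r w ^+ 2 / q0 w)%:E)%E.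
  by rewrite lee_fin divr_ge0 ?sqr_ge0.
have q0E w : [set: W] w -> (0 <= (q0 w)%:E)%E by rewrite lee_fin.
have q1E w : [set: W] w -> (0 <= (q1 w)%:E)%E by rewrite lee_fin.
have q1q1 w : [set: W] w -> (0 <= (q1 w)%:E + (q1 w)%:E)%E.
  by move=> _; apply: adde_ge0; exact: q1E.
have /measurable_EFinP mq0E := mq0.
have /measurable_EFinP mq1E := mq1.
have /measurable_EFinP m1E := m1.
have /measurable_EFinP m2E := m2.
have : (\int[mu]_w ((q1 w ^+ 2 / q0 w)%:E + (q0 w)%:E) =
        \int[mu]_w (((q1 w - q0 w) ^+ 2 / q0 w)%:E + ((q1 w)%:E + (q1 w)%:E)))%E.
  apply: eq_integral => w _; rewrite -!EFinD; congr EFin.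
  have [q0w|q0w] := eqVneq (q0 w) 0.
    by rewrite q0w (dom _ q0w) invr0; ring.
  by field.
rewrite (ge0_integralD mu measurableT (square_ge0 q1) m1E q0E mq0E).
rewrite (ge0_integralD mu measurableT (square_ge0 (fun w => q1 w - q0 w)) m2E q1q1
  (emeasurable_funD mq1E mq1E)).
rewrite (ge0_integralD mu measurableT q1E mq1E q1E mq1E).
rewrite q0_1 q1_1 -/(chi2 mu q1 q0) chic.
case: (\int[mu]_w _)%E => // r [rE]; congr EFin.
lra.
Qed.

(** Sparse signalling multiplies the deviation from the innocent output density by tau, hence the
    chi-squared distance by tau^2. Then (1 + c)^n <= exp(n c), and at the extreme tau the exponent
    is at most 4 xi^2 e^2. *)
Lemma sparse_detection dX dW (X : measurableType dX) (W : measurableType dW)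
    (R : realType) (mu : {sigma_finite_measure set W -> \bar R})
    (p : X -> W -> R) (x0 : X) (Pt : probability X R) (tau : {i01 R})
    (e : R) (n : nat) :
  0 < e -> (0 < n)%N -> channel mu p ->
  dominated (output (sparse tau x0 Pt) p) (p x0) ->
  tau%:num = tau_max mu p x0 Pt e n ->
  detection_le mu (p x0) (output (sparse tau x0 Pt) p) n e.
Proof.
move=> e0 n0 chp dom tauE.
have [mp p0 p1] := chp.
have mix (P : probability X R) w : sparse tau x0 Pt = P ->
    (\int[P]_x (p x w)%:E =
     (1 - tau%:num)%:E * (p x0 w)%:E + tau%:num%:E * \int[Pt]_x (p x w)%:E)%E.
  move=> PE; transitivity (\int[sparse tau x0 Pt]_x (p x w)%:E)%E; first by rewrite PE.
  rewrite integral_sparse// => [|x]; last by rewrite lee_fin.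
  by apply/measurable_EFinP; exact: (measurable_channel_density chp).
have [P PE] := sparse_probability tau x0 Pt.
have := mix P _ PE; move: dom; rewrite {}PE => dom {}mix.
have mq0 := measurable_channel_kernel chp x0.
have mqt := measurable_output chp Pt.
have mq1 := measurable_output chp P.
have chi_ge0 : (0 <= chi2 mu (output Pt p) (p x0))%E.
  by apply: integral_ge0 => w _; rewrite lee_fin divr_ge0 ?sqr_ge0.
set c := tau%:num ^+ 2 * fine (chi2 mu (output Pt p) (p x0)).
have chic : chi2 mu (output P p) (p x0) = c%:E.
  (* An infinite chi-squared distance for [Pt] can occur only in the case tau = 0, since [tau_max]
     is then 0 through division by zero. *)
  have [tau0|tau_neq0] := eqVneq tau%:num 0.
    have q10 w : output P p w = p x0 w.
      by rewrite /output /Rintegral mix tau0 subr0 mul1e mul0e adde0.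
    rewrite /c tau0 expr0n mul0r /chi2; apply: integral0_eq => w _.
    by rewrite q10 subrr expr0n mul0r.
  have chifin : chi2 mu (output Pt p) (p x0) \is a fin_num.
    rewrite ge0_fin_numE// ltNge leye_eq; apply: contra tau_neq0 => /eqP chiy.
    by rewrite tauE /tau_max chiy /= mulr0 sqrtr0 invr0 mulr0.
  have mchi (P' : probability X R) : measurable_fun [set: W]
      (fun w => ((output P' p w - p x0 w) ^+ 2 / p x0 w)%:E).
    apply/measurable_EFinP; apply: measurable_fun_div_ge0 => //.
    by apply: measurable_funX; apply: measurable_funB => //; exact: measurable_output.
  have chi_ge0' w : [set: W] w ->
      (0 <= ((output Pt p w - p x0 w) ^+ 2 / p x0 w)%:E)%E.
    by rewrite lee_fin divr_ge0 ?sqr_ge0.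
  have tau2_ge0 : (0 <= (tau%:num ^+ 2)%:E)%E by rewrite lee_fin sqr_ge0.
  rewrite /c EFinM fineK// /chi2.
  rewrite -(ge0_integralZl mu measurableT (mchi Pt) chi_ge0' tau2_ge0).
  (* The scaling holds only almost everywhere, where both outputs agree with the extended real
     mixtures. *)
  apply: ae_eq_integral => //.
  - by apply: measurable_funeM; exact: mchi.
  - apply: filterS2 (ae_output chp P) (ae_output chp Pt) => w PEw PtEw _.
    have -> : output P p w = (1 - tau%:num) * p x0 w + tau%:num * output Pt p w.
      by apply: EFin_inj; rewrite PEw mix -PtEw.
    by rewrite -EFinM; congr EFin; rewrite mulrA -exprMn; congr (_ ^+ 2 / _); ring.
have S := integral_chi2 mq0 mq1 (p0 x0) (output_ge0 chp P) (p1 x0)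
  (integral_output chp P) dom chic.
apply: (detection_bound e0 mq0 mq1 (p0 x0) (output_ge0 chp P) (p1 x0)
  (integral_output chp P) dom S).
apply: le_trans (expR_xi_le e0); rewrite (@le_trans _ _ (expR c ^+ n))//.
  by rewrite lerXn2r ?nnegrE ?expR_ge0 ?expR_ge1Dx// addr_ge0// mulr_ge0 ?sqr_ge0 ?fine_ge0.
rewrite -expRM_natl ler_expR /c tauE /tau_max; set D := fine _.
have : 0 <= D by exact: fine_ge0.
rewrite le_eqVlt => /predU1P[<-|D0].
  by rewrite !mulr0 mulr_ge0 ?sqr_ge0// mulr_ge0 ?sqr_ge0.
have nR : n%:R != 0 :> R by rewrite pnatr_eq0 -lt0n.
have sE : Num.sqrt (n%:R * D) ^+ 2 = n%:R * D by rewrite sqr_sqrtr// mulr_ge0// ltW.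
rewrite expr_div_n sE le_eqVlt; apply/orP; left; apply/eqP; field.
by rewrite nR gt_eqF.
Qed.

(** * Random coding *)

(** Young's inequality for (a / b)^r and 1 with conjugate exponents 1 / r and 1 / (1 - r); the case
    r = 1, where the second exponent is infinite, is treated apart. *)
Lemma powR_le_tangent (R : realType) (r a b : R) :
  0 < r <= 1 -> 0 <= a -> 0 < b ->
  a `^ r <= b `^ r * (r * (a / b) + (1 - r)).
Proof.
move=> /andP[r0 r1] a0 b0.
have ab0 : 0 <= a / b by rewrite divr_ge0// ltW.
rewrite -{1}(divfK (lt0r_neq0 b0) a) mulrC powRM ?(ltW b0)//.
rewrite ler_wpM2l ?powR_ge0//.
move: r1; rewrite le_eqVlt => /predU1P[->|r1].
  by rewrite powRr1// subrr addr0 mul1r.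
have := @conjugate_powR R ((a / b) `^ r) 1 r^-1 (1 - r)^-1 (powR_ge0 _ _) ler01.
rewrite !invr_gt0 subr_gt0 !invrK powR1 /= mul1r -powRrM mulfV ?gt_eqF// powRr1//.
by move=> /(_ r0 r1); rewrite mulr1 (mulrC r); apply; ring.
Qed.

(** Ties have to be broken measurably. The choice depends on z only through the finite table telling
    which indices are maximisers, and each table occurs on a measurable set. *)
Lemma measurable_argmax d (Z : measurableType d) (R : realType) (M : nat)
    (score : 'I_M -> Z -> R) :
  (0 < M)%N -> (forall m, measurable_fun [set: Z] (score m)) ->
  exists dec : Z -> 'I_M,
    (forall m, measurable [set z | dec z = m]) /\
    (forall z m, score m z <= score (dec z) z).
Proof.
move=> M0 mscore.
pose best z m := [forall m', score m' z <= score m z].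
(* The finite function makes the picked index a function of the table alone. A maximiser always
   exists, so the default is never reached. *)
pose dec z := odflt (Ordinal M0) [pick m | [ffun m => best z m] m].
exists dec; split => [m|z m]; last first.
  rewrite /dec; case: pickP => [m' /=|nobest].
    by rewrite ffunE => /forallP.
  have := nobest [arg max_(m' > Ordinal M0) score m' z]%O.
  rewrite ffunE; case: arg_maxP => //= i _ imax ib.
  suff bi : best z i by rewrite bi in ib.
  by apply/forallP => j; exact: imax.
pose B m := \bigcap_(m' in [set: 'I_M]) [set z | score m' z <= score m z].
have bestE z i : best z i = (z \in B i).
  by apply/forallP/idP; rewrite inE => zi j *; exact: zi.
have mB i : measurable (B i).
  apply: fin_bigcap_measurable; first exact: finite_finset.
  move=> j _; rewrite -[X in measurable X]setTI.
  exact: (measurable_fun_ler (mscore j) (mscore i) measurableT (Y := [set true])).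
rewrite [X in measurable X](_ : _ =
    \bigcup_(b in [set b : {ffun 'I_M -> bool} |
                   odflt (Ordinal M0) [pick m | b m] = m])
    \bigcap_(i in [set: 'I_M]) [set z | (z \in B i) = b i]).
  apply: fin_bigcup_measurable; first exact: finite_finset.
  move=> b _; apply: fin_bigcap_measurable; first exact: finite_finset.
  move=> i _; case: (b i).
    by rewrite (_ : mkset _ = B i)//; apply/seteqP; split=> z /= => [/set_mem|/mem_set].
  rewrite (_ : mkset _ = ~` B i); first exact: measurableC.
  by apply/seteqP; split=> z /= => [/negbT|zB]; [|apply/negbTE]; rewrite notin_setE.
apply/seteqP; split => [z /= zm|z [b /= bm bz]].
  by exists [ffun m => best z m] => // i _ /=; rewrite ffunE bestE.
rewrite /dec (_ : [ffun m => best z m] = b)//.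
by apply/ffunP => i; rewrite ffunE bestE bz.
Qed.

Section codebook_integrals.
Context d (T : measurableType d) (R : realType).
Variables (I : (T -> \bar R) -> \bar R) (nu : {sigma_finite_measure set T -> \bar R}).
Hypotheses (Inu : integrates I nu) (nu1 : nu [set: T] = 1%E).
Variables (M : nat) (nuC : {measure set (M.-tuple T) -> \bar R}).
Hypothesis InuC : integrates (iter_int I (n := M)) nuC.
Variables (u : T -> R).
Hypotheses (mu : measurable_fun [set: T] u) (u0 : forall x, 0 <= u x).

Let muE : measurable_fun [set: T] (fun x => (u x)%:E).
Proof. exact/measurable_EFinP. Qed.

Lemma codebook_measure1 : nuC [set: M.-tuple T] = 1%E.
Proof.
rewrite -[LHS]mul1e -integral_cst// -InuC//.
transitivity (iter_int I (fun c : M.-tuple T => \prod_(i < M) cst 1%E (tnth c i))%E).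
  by congr iter_int; apply/funext => c; rewrite big1.
rewrite (iter_int_prod (h := fun=> cst 1%E) Inu)// big1// => i _.
by rewrite integral_cst// mul1e.
Qed.

(** Factors 1 outside [D] turn a product over some code words into a product over all of them, the
    form to which [iter_int_prod] applies. Singletons give the law of a code word, pairs the
    pairwise independence. *)
Let select (D : {set 'I_M}) (i : 'I_M) (x : T) : \bar R :=
  if i \in D then (u x)%:E else 1%E.

Let integral_select D :
  (\int[nuC]_c (\prod_(i < M) select D i (tnth c i)) =
   \prod_(i in D) \int[nu]_x (u x)%:E)%E.
Proof.
have mselect i : measurable_fun [set: T] (select D i).
  by rewrite /select; case: (i \in D).
have select_ge0 i x : (0 <= select D i x)%E.
  by rewrite /select; case: ifP => //; rewrite lee_fin.
rewrite -InuC; last 2 first.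
- apply: emeasurable_prod => i; apply: measurableT_comp => //.
  exact: measurable_tnth.
- by move=> c; apply: prode_ge0.
rewrite (iter_int_prod Inu)// [RHS]big_mkcond /=; apply: eq_bigr => i _.
by rewrite /select; case: ifP => // _; rewrite integral_cst// mul1e.
Qed.

Let prod_select D c :
  (\prod_(i < M) select D i (tnth c i))%E = (\prod_(i in D) u (tnth c i))%:E.
Proof.
rewrite -prodEFin [RHS]big_mkcond; apply: eq_bigr => i _.
by rewrite /select; case: ifP.
Qed.

Lemma integral_codeword m :
  (\int[nuC]_c (u (tnth c m))%:E)%E = (\int[nu]_x (u x)%:E)%E.
Proof.
have := integral_select [set m]; rewrite big_set1 => <-.
by apply: eq_integral => c _; rewrite prod_select big_set1.
Qed.

Lemma integral_codeword2 m m' : m != m' ->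
  (\int[nuC]_c (u (tnth c m) * u (tnth c m'))%:E =
   \int[nu]_x (u x)%:E * \int[nu]_x (u x)%:E)%E.
Proof.
move=> mm'; have := integral_select [set m; m'].
rewrite big_setU1 ?inE// big_set1 => <-.
by apply: eq_integral => c _; rewrite prod_select big_setU1 ?inE// big_set1.
Qed.

End codebook_integrals.

(* Linearising [a^rho] at [b = (M - 1) g] replaces Jensen's inequality, so that
   only the pairwise independence of the code words is needed. *)
Lemma codebook_jensen d (T : measurableType d) (R : realType)
    (I : (T -> \bar R) -> \bar R) (nu : {sigma_finite_measure set T -> \bar R})
    (M : nat) (nuC : {measure set (M.-tuple T) -> \bar R}) (u : T -> R)
    (rho : R) (m : 'I_M) :
  integrates I nu -> nu [set: T] = 1%E -> integrates (iter_int I (n := M)) nuC ->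
  measurable_fun [set: T] u -> (forall x, 0 <= u x) -> 0 < rho <= 1 ->
  (\int[nuC]_c (u (tnth c m) * (\sum_(i < M | i != m) u (tnth c i)) `^ rho)%:E <=
   (M.-1%:R `^ rho)%:E * (\int[nu]_x (u x)%:E) `^ (1 + rho))%E.
Proof.
move=> Inu nu1 InuC mu u0 rho01; have /andP[rho0 rho1] := rho01.
have mui i : measurable_fun [set: M.-tuple T] (fun c => u (tnth c i)).
  by apply: measurableT_comp => //; exact: measurable_tnth.
pose S (c : M.-tuple T) := \sum_(i < M | i != m) u (tnth c i).
have S_ge0 c : 0 <= S c by apply: sumr_ge0.
have mS : measurable_fun [set: M.-tuple T] S.
  rewrite /S; under eq_fun do rewrite big_mkcond.
  by apply: measurable_sum => i; case: (i != m).
have mSr : measurable_fun [set: M.-tuple T] (fun c => S c `^ rho).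
  exact: (measurableT_comp (measurable_powR rho) mS).
have card_other : #|[pred i : 'I_M | i != m]| = M.-1.
  by rewrite (eq_card (B := predC1 m))// cardC1 card_ord.
(* With a single message the sum over competitors is empty, and its power is 0 because rho is
   positive. *)
have [M1|M1] := eqVneq M.-1 0%N.
  rewrite [leLHS](_ : _ = 0%E).
    by rewrite mule_ge0 ?poweR_ge0// lee_fin powR_ge0.
  apply: integral0_eq => c _; rewrite big_pred0.
    by rewrite powR0 ?gt_eqF// mulr0.
  by move=> i; move: card_other; rewrite M1 => /card0_eq/(_ i).
have k0 : 0 < M.-1%:R :> R by rewrite ltr0n lt0n.
have : (0 <= \int[nu]_x (u x)%:E)%E by apply: integral_ge0 => x _; rewrite lee_fin.
case gE : (\int[nu]_x (u x)%:E)%E => [g| |]// => [|_]; last first.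
  rewrite poweRyr ?gt_eqF ?addr_gt0// gt0_muley ?leey// lte_fin.
  exact: powR_gt0.
rewrite lee_fin => g0.
(* The tangent point must be positive. For g = 0 any positive value serves, as the integrated
   tangent bound is then 0. *)
pose b := if g == 0 then 1 else M.-1%:R * g.
have b0 : 0 < b.
  by rewrite /b; case: ifPn => // gn0; rewrite mulr_gt0// lt0r gn0.
pose k1 := b `^ rho * (rho / b); pose k2 := b `^ rho * (1 - rho).
have k1_ge0 : 0 <= k1 by rewrite mulr_ge0 ?powR_ge0// divr_ge0 ?ltW.
have k2_ge0 : 0 <= k2 by rewrite mulr_ge0 ?powR_ge0// subr_ge0.
pose pairs (c : M.-tuple T) := \sum_(i < M | i != m) u (tnth c m) * u (tnth c i).
have mpairs : measurable_fun [set: M.-tuple T] pairs.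
  rewrite /pairs; under eq_fun do rewrite big_mkcond.
  by apply: measurable_sum => i; case: (i != m) => //; exact: measurable_funM.
have pairs_ge0 c : 0 <= pairs c by apply: sumr_ge0 => i _; exact: mulr_ge0.
have int_pairs : (\int[nuC]_c (pairs c)%:E = (M.-1%:R * (g * g))%:E)%E.
  under eq_integral do rewrite -sumEFin big_mkcond.
  rewrite ge0_integral_sum//=; last 2 first.
  - move=> i; case: (i != m) => //.
    by apply/measurable_EFinP; exact: measurable_funM.
  - by move=> i c _; case: ifP => // _; rewrite lee_fin mulr_ge0.
  rewrite (eq_bigr (fun i => if i != m then (g * g)%:E else 0%E)); last first.
    move=> i _; case: ifPn => im; last exact: integral0.
    by rewrite (integral_codeword2 Inu nu1 InuC mu u0) 1?eq_sym// gE.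
  rewrite -big_mkcond sumEFin; congr EFin.
  by rewrite sumr_const card_other mulr_natl.
apply: (@le_trans _ _ (\int[nuC]_c ((k1 * pairs c)%:E + (k2 * u (tnth c m))%:E))%E).
  apply: ge0_le_integral => //.
  - by move=> c _; rewrite lee_fin mulr_ge0 ?powR_ge0.
  - by apply/measurable_EFinP; exact: measurable_funM.
  - by apply: emeasurable_funD; apply/measurable_EFinP; exact: measurable_funM.
  - move=> c _; rewrite -EFinD lee_fin.
    rewrite /pairs -mulr_sumr -/(S c) mulrCA [k2 * _]mulrC -mulrDr ler_wpM2l//.
    rewrite (le_trans (powR_le_tangent rho01 (S_ge0 c) b0))//.
    by rewrite /k1 /k2 le_eqVlt; apply/orP; left; apply/eqP; ring.
rewrite ge0_integralD//; [|by move=> c _; rewrite lee_fin mulr_ge0|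
  by apply/measurable_EFinP; exact: measurable_funM|
  by move=> c _; rewrite lee_fin mulr_ge0|
  by apply/measurable_EFinP; exact: measurable_funM].
under eq_integral do rewrite EFinM.
under [X in (_ + X)%E]eq_integral do rewrite EFinM.
rewrite !ge0_integralZl//; [|by apply/measurable_EFinP|by move=> c _; rewrite lee_fin|
  by apply/measurable_EFinP|by move=> c _; rewrite lee_fin].
rewrite int_pairs (integral_codeword Inu nu1 InuC mu u0) gE poweR_EFin -!EFinM -EFinD lee_fin.
have [g00|gn0] := eqVneq g 0.
  by rewrite g00 !mulr0 addr0 mulr_ge0 ?powR_ge0.
rewrite /k1 /k2 /b (negbTE gn0) powRM ?ler0n// powRD ?gn0 ?implybT// powRr1//.
rewrite le_eqVlt; apply/orP; left; apply/eqP; field.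
by rewrite gn0 gt_eqF.
Qed.

Lemma poweR_prod (R : realType) (J : Type) (l : seq J) (h : J -> \bar R) (r : R) :
  (forall j, 0 <= h j)%E ->
  ((\prod_(j <- l) h j) `^ r = \prod_(j <- l) h j `^ r)%E.
Proof.
move=> h0; elim: l => [|j l IH]; first by rewrite !big_nil poweR1r.
by rewrite !big_cons poweRM ?prode_ge0// IH.
Qed.

Lemma powR_prod (R : realType) (J : Type) (l : seq J) (h : J -> R) (r : R) :
  (forall j, 0 <= h j) ->
  (\prod_(j <- l) h j) `^ r = \prod_(j <- l) h j `^ r.
Proof.
move=> h0; elim: l => [|j l IH]; first by rewrite !big_nil powR1.
by rewrite !big_cons powRM ?prodr_ge0// IH.
Qed.

Section random_coding.
Context dX dY (X : measurableType dX) (Y : measurableType dY) (R : realType).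
Variables (mu : {sigma_finite_measure set Y -> \bar R}) (p : X -> Y -> R).
Hypothesis chp : channel mu p.
Variables (P : probability X R) (n M : nat).

Definition likelihood (x : n.-tuple X) (y : n.-tuple Y) : R :=
  \prod_(i < n) p (tnth x i) (tnth y i).

Lemma likelihood_ge0 x y : 0 <= likelihood x y.
Proof. by case: chp => _ p0 _; exact: prodr_ge0. Qed.

Lemma measurable_likelihood :
  measurable_fun [set: n.-tuple X * n.-tuple Y] (fun z => likelihood z.1 z.2).
Proof.
case: chp => mp _ _; apply: measurable_prod => i _.
have mletters : measurable_fun [set: n.-tuple X * n.-tuple Y]
    (fun z => (tnth z.1 i, tnth z.2 i)).
  by apply: measurable_fun_pair;
    apply: (measurableT_comp (measurable_tnth i)).
exact: (measurableT_comp mp mletters).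
Qed.

Lemma measurable_codeword_likelihood (m : 'I_M) :
  measurable_fun [set: M.-tuple (n.-tuple X) * n.-tuple Y]
    (fun z => likelihood (tnth z.1 m) z.2).
Proof.
have mword : measurable_fun [set: M.-tuple (n.-tuple X) * n.-tuple Y]
    (fun z => (tnth z.1 m, z.2)).
  apply: measurable_fun_pair => //.
  by apply: (measurableT_comp (measurable_tnth m)).
exact: (measurableT_comp measurable_likelihood mword).
Qed.

Variables (nuX : {sigma_finite_measure set (n.-tuple X) -> \bar R})
          (nuC : {sigma_finite_measure set (M.-tuple (n.-tuple X)) -> \bar R})
          (nuY : {sigma_finite_measure set (n.-tuple Y) -> \bar R}).
Let IX (f : n.-tuple X -> \bar R) := iter_int (fun g => \int[P]_x g x)%E f.
Hypotheses (InuX : integrates IX nuX) (InuC : integrates (iter_int IX (n := M)) nuC)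
  (InuY : integrates (iter_int (fun g => \int[mu]_y g y)%E (n := n)) nuY).

Variable dec : decoding_rule X Y n M.
Hypothesis mdec : measurable_rule dec.

Let err (m : 'I_M) (z : M.-tuple (n.-tuple X) * n.-tuple Y) : R :=
  (dec z.1 z.2 != m)%:R * likelihood (tnth z.1 m) z.2.

Let err_ge0 m z : 0 <= err m z.
Proof. by rewrite mulr_ge0// likelihood_ge0. Qed.

Let measurable_err m : measurable_fun setT (err m).
Proof.
apply: measurable_funM; last exact: measurable_codeword_likelihood.
rewrite (_ : (fun z => _) = \1_(~` [set z | dec z.1 z.2 = m])).
  by apply: measurable_indic; apply: measurableC; exact: mdec.
apply/funext => z; rewrite indicE in_setC; congr (_%:R); congr (nat_of_bool (~~ _)).
by apply/eqP/idP; rewrite inE.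
Qed.

Let codebook_errorE c :
  codebook_error mu p dec c =
  ((M%:R^-1)%:E * \sum_(m < M) \int[nuY]_y (err m (c, y))%:E)%E.
Proof.
congr (_ * _)%E; apply: eq_bigr => m _; rewrite -InuY//.
- apply/measurable_EFinP; exact: (measurable_fun_pair2 c (measurable_err m)).
- by move=> y; rewrite lee_fin.
Qed.

Let measurable_inner m :
  measurable_fun setT (fun c => \int[nuY]_y (err m (c, y))%:E)%E.
Proof.
have mE : measurable_fun setT (fun z => (err m z)%:E).
  by apply/measurable_EFinP.
by apply: (measurable_fun_fubini_tonelli_F (m2 := nuY) _ mE) => z; rewrite lee_fin.
Qed.

Let inner_ge0 m c : (0 <= \int[nuY]_y (err m (c, y))%:E)%E.
Proof. by apply: integral_ge0 => y _; rewrite lee_fin. Qed.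

Let codebook_error_ge0 c : (0 <= codebook_error mu p dec c)%E.
Proof. by rewrite codebook_errorE mule_ge0 ?lee_fin// sume_ge0. Qed.

Let measurable_codebook_error : measurable_fun setT (codebook_error mu p dec).
Proof.
rewrite (funext codebook_errorE); apply: measurable_funeM.
by apply: emeasurable_sum.
Qed.

Let average_errorE :
  average_error mu p P dec = (\int[nuC]_c codebook_error mu p dec c)%E.
Proof. exact: InuC. Qed.

Let nuX1 : nuX [set: n.-tuple X] = 1%E.
Proof.
have P1 : (P : {measure set X -> \bar R}) [set: X] = 1%E := probability_setT P.
exact: (codebook_measure1 (integrates_self P) P1 InuX).
Qed.

(** The law of the codebooks has mass 1, so if every codebook had an error above r the average would
    be at least r. *)
Lemma codebook_exists (r : R) :
  (average_error mu p P dec < r%:E)%E ->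
  exists c, (codebook_error mu p dec c <= r%:E)%E.
Proof.
move=> avg; apply: contrapT => /forallNP none.
have nuC1 := codebook_measure1 InuX nuX1 InuC.
move: avg; rewrite average_errorE ltNge => /negP; apply.
have [r0|r0] := leP r 0.
  by rewrite (le_trans (y := 0%E)) ?lee_fin//; apply: integral_ge0.
rewrite -[leLHS]mule1 -nuC1 -integral_cst//.
apply: ge0_le_integral => //.
- by move=> c _; rewrite lee_fin ltW.
- by move=> c _ /=; rewrite leNgt; apply/negP => /ltW; exact: none.
Qed.

Variable rho : R.
Hypothesis rho01 : 0 < rho <= 1.
Let s := (1 + rho)^-1.

Let mixture (y : Y) : \bar R := (\int[P]_x (p x y `^ s)%:E)%E.

Let mixture_ge0 y : (0 <= mixture y)%E.
Proof. by apply: integral_ge0 => x _; rewrite lee_fin powR_ge0. Qed.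

Let measurable_mixture : measurable_fun [set: Y] mixture.
Proof.
case: chp => mp p0 _.
have mpE : measurable_fun [set: X * Y] (fun z => (p z.1 z.2 `^ s)%:E).
  by apply/measurable_EFinP; exact: (measurableT_comp (measurable_powR s) mp).
apply: (measurable_fun_fubini_tonelli_G (m1 := P) _ mpE) => z.
by rewrite lee_fin powR_ge0.
Qed.

Let word_mixture (y : n.-tuple Y) :
  (\int[nuX]_x (likelihood x y `^ s)%:E = \prod_(i < n) mixture (tnth y i))%E.
Proof.
case: (chp) => mp p0 _.
have mh i : measurable_fun [set: X] (fun x => (p x (tnth y i) `^ s)%:E).
  apply/measurable_EFinP; apply: (measurableT_comp (measurable_powR s)).
  exact: (measurable_channel_density chp).
have h0 i x : (0 <= (p x (tnth y i) `^ s)%:E)%E by rewrite lee_fin powR_ge0.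
rewrite -(iter_int_prod (integrates_self P) mh h0) -InuX.
- congr iter_int; apply/funext => x; rewrite prodEFin; congr EFin.
  by rewrite /likelihood powR_prod.
- apply/measurable_EFinP; apply: (measurableT_comp (measurable_powR s)).
  exact: (measurable_fun_pair1 y measurable_likelihood).
- by move=> x; rewrite lee_fin powR_ge0.
Qed.

Hypothesis ml : forall c y m,
  likelihood (tnth c m) y <= likelihood (tnth c (dec c y)) y.

(** Gallager's form of the union bound. As s (1 + rho) = 1, the likelihood f of word m splits as f^s
    (f^s)^rho; on an error the second f^s is at most the term of the decoded word, which is one of
    the summands. *)
Let err_ml m c y :
  err m (c, y) <= likelihood (tnth c m) y `^ s *
    (\sum_(i < M | i != m) likelihood (tnth c i) y `^ s) `^ rho.
Proof.
have /andP[rho0 rho1] := rho01.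
rewrite /err /=; have [_|dm] := eqVneq (dec c y) m.
  by rewrite mul0r mulr_ge0 ?powR_ge0.
have s0 : 0 <= s by rewrite invr_ge0 addr_ge0// ltW.
set f := likelihood (tnth c m) y.
have f0 : 0 <= f by exact: likelihood_ge0.
have ss : s + s * rho = 1.
  by rewrite /s; field; rewrite gt_eqF// addr_gt0.
have -> : true%:R * f = f `^ s * (f `^ s) `^ rho.
  by rewrite mul1r -powRrM -powRD ss ?powRr1// oner_eq0.
rewrite ler_wpM2l ?powR_ge0// ge0_ler_powR ?(ltW rho0)// ?nnegrE ?powR_ge0//.
  by apply: sumr_ge0 => i _; exact: powR_ge0.
rewrite (bigD1 (dec c y))//= -[leLHS]addr0 lerD//.
  by apply: ge0_ler_powR; rewrite ?nnegrE ?likelihood_ge0//; exact: ml.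
by apply: sumr_ge0 => i _; exact: powR_ge0.
Qed.

(** Averaging over codebooks first, with the output word fixed, gives the setting of
    [codebook_jensen] for u = likelihood^s. The mixture over words then factorises over the letters,
    each of which contributes a factor G. *)
Lemma gallager_bound (G : R) : (0 < M)%N -> 0 <= G ->
  (\int[mu]_y (\int[P]_x (p x y `^ (1 + rho)^-1)%:E) `^ (1 + rho))%E = G%:E ->
  (average_error mu p P dec <= (M.-1%:R `^ rho * G ^+ n)%:E)%E.
Proof.
move=> M0 G0 GE.
have mE m : measurable_fun setT (fun z => (err m z)%:E).
  by apply/measurable_EFinP.
have errz m z : (0 <= (err m z)%:E)%E by rewrite lee_fin.
rewrite average_errorE (funext codebook_errorE).
rewrite ge0_integralZl//; last 2 first.
- by apply: emeasurable_sum.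
- by move=> c _; apply: sume_ge0.
rewrite ge0_integral_sum//.
(* Written as an average of M equal terms, the bound can be proved for each message separately. *)
have -> : (M.-1%:R `^ rho * G ^+ n)%:E =
    ((M%:R^-1)%:E * \sum_(m < M) (M.-1%:R `^ rho * G ^+ n)%:E)%E.
  rewrite sumEFin sumr_const card_ord -EFinM; congr EFin.
  rewrite -[(_ * G ^+ n) *+ M]mulr_natl mulKf//.
  by rewrite pnatr_eq0 -lt0n.
rewrite lee_wpmul2l ?lee_fin//; apply: lee_sum => m _.
rewrite (fubini_tonelli (m1 := nuC) (m2 := nuY) _ (mE m) (errz m)).
have mword : measurable_fun [set: n.-tuple Y]
    (fun y => \prod_(i < n) mixture (tnth y i) `^ (1 + rho))%E.
  apply: emeasurable_prod => i.
  apply: (measurableT_comp (measurable_poweR (1 + rho))).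
  by apply: (measurableT_comp measurable_mixture); exact: measurable_tnth.
apply: (@le_trans _ _ (\int[nuY]_y
    ((M.-1%:R `^ rho)%:E * \prod_(i < n) mixture (tnth y i) `^ (1 + rho)))%E).
  apply: ge0_le_integral => //.
  - by move=> y _; apply: integral_ge0 => c _.
  - exact: (measurable_fun_fubini_tonelli_G (m1 := nuC) _ (mE m) (errz m)).
  - exact: measurable_funeM.
  - move=> y _.
    have mu' : measurable_fun setT (fun x => likelihood x y `^ s).
      apply: (measurableT_comp (measurable_powR s)).
      exact: (measurable_fun_pair1 y measurable_likelihood).
    have mJ : measurable_fun setT (fun c : M.-tuple (n.-tuple X) =>
        likelihood (tnth c m) y `^ s *
        (\sum_(i < M | i != m) likelihood (tnth c i) y `^ s) `^ rho).
      have mi i : measurable_fun setT (fun c : M.-tuple (n.-tuple X) =>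
          likelihood (tnth c i) y `^ s).
        exact: (measurableT_comp mu' (measurable_tnth i)).
      apply: measurable_funM => //.
      apply: (measurableT_comp (measurable_powR rho)).
      under eq_fun do rewrite big_mkcond.
      by apply: measurable_sum => i; case: (i != m).
    have := codebook_jensen m InuX nuX1 InuC mu' (fun x => powR_ge0 _ _) rho01.
    rewrite word_mixture; set J := (X in (X <= _)%E -> _) => Jle.
    apply: (@le_trans _ _ J).
      apply: ge0_le_integral => //.
      + exact: (measurable_fun_pair1 y (mE m)).
      + apply/measurable_EFinP; exact: mJ.
      + by move=> c _; rewrite lee_fin; exact: err_ml.
    by apply: (le_trans Jle); rewrite poweR_prod.
rewrite ge0_integralZl//; last first.
  by move=> y _; apply: prode_ge0 => i _; exact: poweR_ge0.
rewrite EFinM lee_wpmul2l ?lee_fin ?powR_ge0//.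
rewrite -InuY//; last by move=> y; apply: prode_ge0 => i _; exact: poweR_ge0.
rewrite (iter_int_prod (h := fun=> fun y => mixture y `^ (1 + rho))%E (integrates_self mu)).
- by rewrite (eq_bigr (fun=> G%:E))// prodEFin prodr_const card_ord.
- by move=> i; exact: (measurableT_comp (measurable_poweR (1 + rho)) measurable_mixture).
- by move=> i y; exact: poweR_ge0.
Qed.

End random_coding.

(** * Gallager's function *)

(** The tangent of z^(1/r) at h^r is increasing with value h there, so a value of at least h at q
    places q beyond h^r. This closes the tangent arguments in which h is a mean. *)
Lemma powR_le_of_tangent (R : realType) (r h q : R) :
  0 < r -> 0 < h -> h <= h * (r^-1 * (q / h `^ r) + (1 - r^-1)) -> h `^ r <= q.
Proof.
move=> r0 h0; rewrite -{1}[h]mulr1 ler_pM2l// => le1.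
have : 0 <= r^-1 * (q / h `^ r - 1) by lra.
by rewrite pmulr_rge0 ?invr_gt0// subr_ge0 ler_pdivlMr ?powR_gt0// mul1r.
Qed.

(* The tangent of [z `^ r^-1] at [h `^ r], where it takes the value [h]. *)
Lemma powR_tangent_at (R : realType) (r h z : R) :
  1 <= r -> 0 < h -> 0 <= z ->
  z `^ r^-1 <= h * (r^-1 * (z / h `^ r) + (1 - r^-1)).
Proof.
move=> r1 h0 z0; have r0 : 0 < r by exact: (lt_le_trans ltr01 r1).
have := @powR_le_tangent _ r^-1 z (h `^ r) _ z0 (powR_gt0 r h0).
rewrite invr_gt0 r0 invf_le1// r1 -powRrM mulfV ?gt_eqF// powRr1 ?(ltW h0)//.
exact.
Qed.

(** With S = 1 - t + t A, the base on the left is S times the mean of u and v / A for the weights (1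
    - t) / S and t A / S, and the power is convex. If u^r has integral 1 and v^r at most A^r,
    integration yields S^r: this is Minkowski's inequality in pointwise form. *)
Lemma powR_convex_scaled (R : realType) (r t A u v : R) :
  1 <= r -> 0 <= t <= 1 -> 0 < A -> 0 <= u -> 0 <= v ->
  ((1 - t) * u + t * v) `^ r <=
  (1 - t + t * A) `^ r *
  ((1 - t) / (1 - t + t * A) * u `^ r + t * A / (1 - t + t * A) / A `^ r * v `^ r).
Proof.
move=> r1 /andP[t0 t1] A0 u0 v0; set S := 1 - t + t * A.
have r0 : 0 < r by exact: (lt_le_trans ltr01 r1).
have t1' : 0 <= 1 - t by rewrite subr_ge0.
have S0 : 0 < S.
  rewrite /S; have [->|tn1] := eqVneq t 1; first by rewrite subrr add0r mul1r.
  by rewrite ltr_pwDl ?mulr_ge0 ?(ltW A0)// subr_gt0 lt_neqAle tn1.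
pose w1 := (1 - t) / S; pose w2 := t * A / S.
have w1_ge0 : 0 <= w1 by rewrite divr_ge0 ?(ltW S0).
have w2_ge0 : 0 <= w2 by rewrite divr_ge0 ?(ltW S0)// mulr_ge0 ?(ltW A0).
have w12 : w1 + w2 = 1 by rewrite /w1 /w2 -mulrDl divff ?gt_eqF.
pose F := w1 * u + w2 * (v / A).
have FE : (1 - t) * u + t * v = S * F.
  by rewrite /F /w1 /w2; field; rewrite !gt_eqF.
have vA0 : 0 <= v / A by rewrite divr_ge0 ?(ltW A0).
have F_ge0 : 0 <= F by apply: addr_ge0; apply: mulr_ge0.
rewrite FE powRM ?(ltW S0)// ler_wpM2l ?powR_ge0//.
rewrite -/w1 -/w2 (_ : w2 / A `^ r * v `^ r = w2 * (v / A) `^ r); last first.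
  rewrite -[v in LHS](divfK (lt0r_neq0 A0)) (powRM r vA0 (ltW A0)).
  by rewrite [_ `^ r * A `^ r]mulrC mulrA divfK// gt_eqF// powR_gt0.
have Q_ge0 : 0 <= w1 * u `^ r + w2 * (v / A) `^ r.
  by apply: addr_ge0; apply: mulr_ge0 => //; exact: powR_ge0.
have [->|Fn0] := eqVneq F 0; first by rewrite powR0 ?gt_eqF.
have F0 : 0 < F by rewrite lt0r Fn0.
apply: powR_le_of_tangent => //.
(* This is applied at u and at v / A; the weighted sum of the two inequalities has F itself on the
   left. *)
have tan z : 0 <= z -> z <= F * (r^-1 * (z `^ r / F `^ r) + (1 - r^-1)).
  move=> z0; have := powR_tangent_at r1 F0 (powR_ge0 z r).
  by rewrite -powRrM mulfV ?gt_eqF// powRr1.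
have := ler_wpM2l w1_ge0 (tan _ u0); have := ler_wpM2l w2_ge0 (tan _ vA0).
move=> h2 h1; apply: le_trans (lerD h1 h2 : F <= _) _.
rewrite le_eqVlt; apply/orP; left; apply/eqP.
have Fr : F `^ r != 0 by rewrite gt_eqF ?powR_gt0.
have rn0 : r != 0 by rewrite gt_eqF.
move: (u `^ r) ((v / A) `^ r) (F `^ r) Fr => ur vr Fr Frn0.
have -> : w1 = 1 - w2 by rewrite -w12 addrK.
by clearbody F w2; field; rewrite rn0.
Qed.

(** Jensen's inequality: the tangent at an arbitrary h^r is integrated, and h is then taken to be
    the mean of u^(1/r). *)
Lemma powR_mean_le d (X : measurableType d) (R : realType) (P : probability X R)
    (u : X -> R) (r : R) :
  1 <= r -> measurable_fun [set: X] u -> (forall x, 0 <= u x) ->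
  ((\int[P]_x (u x `^ r^-1)%:E) `^ r <= \int[P]_x (u x)%:E)%E.
Proof.
move=> r1 mu u0; have r0 : 0 < r by exact: (lt_le_trans ltr01 r1).
have int0 : (0 <= \int[P]_x (u x)%:E)%E.
  by apply: integral_ge0 => x _; rewrite lee_fin.
have tangent h : 0 < h -> (\int[P]_x (u x `^ r^-1)%:E <=
    (h * r^-1 / h `^ r)%:E * \int[P]_x (u x)%:E + (h * (1 - r^-1))%:E)%E.
  move=> h0.
  have c_ge0 : 0 <= h * r^-1 / h `^ r.
    by rewrite divr_ge0 ?powR_ge0// mulr_ge0 ?invr_ge0 ?ltW.
  have c'_ge0 : 0 <= h * (1 - r^-1).
    by rewrite mulr_ge0 ?(ltW h0)// subr_ge0 invf_le1.
  have uE x : [set: X] x -> (0 <= (u x)%:E)%E by rewrite lee_fin.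
  have /measurable_EFinP muE := mu.
  apply: (@le_trans _ _
    (\int[P]_x ((h * r^-1 / h `^ r)%:E * (u x)%:E + (h * (1 - r^-1))%:E))%E).
    apply: ge0_le_integral => //.
    - by move=> x _; rewrite lee_fin powR_ge0.
    - apply/measurable_EFinP; exact: (measurableT_comp (measurable_powR _) mu).
    - by apply: emeasurable_funD => //; exact: measurable_funeM.
    - move=> x _; rewrite -EFinM -EFinD lee_fin.
      apply: (le_trans (powR_tangent_at r1 h0 (u0 x))).
      by rewrite le_eqVlt; apply/orP; left; apply/eqP; ring.
  rewrite ge0_integralD//; last 2 first.
  - by move=> x _; rewrite mule_ge0// lee_fin.
  - exact: measurable_funeM.
  rewrite ge0_integralZl// integral_cst//.
  have P1 : (P : {measure set X -> \bar R}) [set: X] = 1%E := probability_setT P.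
  by rewrite P1 mule1.
move: tangent int0; case: (\int[P]_x (u x)%:E)%E => [q| |]// tangent; last first.
  by move=> _; rewrite leey.
rewrite lee_fin => q0.
have : (0 <= \int[P]_x (u x `^ r^-1)%:E)%E.
  by apply: integral_ge0 => x _; rewrite lee_fin powR_ge0.
move: tangent; case: (\int[P]_x (u x `^ r^-1)%:E)%E => [h| |]// tangent; last first.
  (* The tangent at 1 shows that the mean of u^(1/r) is finite when that of u is. *)
  by have := tangent 1 ltr01; rewrite -EFinM -EFinD leye_eq.
rewrite !lee_fin le_eqVlt => /predU1P[<-|h0]; first by rewrite powR0 ?gt_eqF.
apply: powR_le_of_tangent => //.
have := tangent h h0; rewrite -EFinM -EFinD lee_fin => /le_trans; apply.
by rewrite le_eqVlt; apply/orP; left; apply/eqP; ring.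
Qed.

Section gallager_function.
Context dX dY (X : measurableType dX) (Y : measurableType dY) (R : realType).
Variables (mu : {sigma_finite_measure set Y -> \bar R}) (p : X -> Y -> R).
Hypothesis chp : channel mu p.
Variable rho : R.
Hypothesis rho_gt0 : 0 < rho.

(* [exp (- E_0)] before truncation to a real number. *)
Definition gallager_integral (P : {measure set X -> \bar R}) : \bar R :=
  (\int[mu]_y (\int[P]_x (p x y `^ (1 + rho)^-1)%:E) `^ (1 + rho))%E.

Let r_ge1 : 1 <= 1 + rho. Proof. by rewrite lerDl ltW. Qed.
Let r_gt0 : 0 < 1 + rho. Proof. exact: (lt_le_trans ltr01 r_ge1). Qed.

Lemma gallager_integral_ge0 P : (0 <= gallager_integral P)%E.
Proof. by apply: integral_ge0 => y _; exact: poweR_ge0. Qed.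

Let mpow : measurable_fun [set: X * Y] (fun z => (p z.1 z.2 `^ (1 + rho)^-1)%:E).
Proof.
case: chp => mp _ _.
by apply/measurable_EFinP; exact: (measurableT_comp (measurable_powR _) mp).
Qed.

Lemma measurable_gallager_integrand (P : probability X R) :
  measurable_fun [set: Y]
    (fun y => (\int[P]_x (p x y `^ (1 + rho)^-1)%:E) `^ (1 + rho))%E.
Proof.
apply: (measurableT_comp (measurable_poweR (1 + rho))).
apply: (measurable_fun_fubini_tonelli_G (m1 := P) _ mpow) => z.
by rewrite lee_fin powR_ge0.
Qed.

(** Jensen's inequality at each output; it makes E_0 nonnegative and the integral finite. *)
Lemma gallager_integral_le1 (P : probability X R) : (gallager_integral P <= 1)%E.
Proof.
rewrite -(integral_mixture chp P); apply: ge0_le_integral => //.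
- by move=> y _; exact: poweR_ge0.
- exact: measurable_gallager_integrand.
- exact: (measurable_mixture chp P).
- move=> y _; case: (chp) => _ p0 _; apply: powR_mean_le => //.
  exact: (measurable_channel_density chp).
Qed.

(** The triangle inequality in L^(1 + rho) over the outputs: with weights 1 - tau and tau, the
    innocent symbol contributes a function of norm 1 and [Pt] one of norm at most A. *)
Lemma gallager_integral_sparse (x0 : X) (Pt : probability X R) (tau : {i01 R})
    (A : R) :
  0 < A -> (gallager_integral Pt <= (A `^ (1 + rho))%:E)%E ->
  (gallager_integral (sparse tau x0 Pt) <=
   ((1 - tau%:num + tau%:num * A) `^ (1 + rho))%:E)%E.
Proof.
move=> A0 GA; case: (chp) => mp p0 p1.
have t01 : 0 <= tau%:num <= 1 by apply/andP; split.
have /andP[t0 t1] := t01.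
set t := tau%:num; set S := 1 - t + t * A; set r := 1 + rho.
have t1' : 0 <= 1 - t by rewrite subr_ge0.
have S0 : 0 < S.
  rewrite /S; have [->|tn1] := eqVneq t 1; first by rewrite subrr add0r mul1r.
  by rewrite ltr_pwDl ?mulr_ge0 ?(ltW A0)// subr_gt0 lt_neqAle tn1.
pose w1 := S `^ r * ((1 - t) / S); pose w2 := S `^ r * (t * A / S / A `^ r).
have w1_ge0 : 0 <= w1 by rewrite mulr_ge0 ?powR_ge0// divr_ge0 ?(ltW S0).
have w2_ge0 : 0 <= w2.
  by rewrite mulr_ge0 ?powR_ge0// divr_ge0 ?powR_ge0// divr_ge0 ?(ltW S0)// mulr_ge0 ?(ltW A0).
have pointwise y : ((\int[sparse tau x0 Pt]_x (p x y `^ r^-1)%:E) `^ r <=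
    w1%:E * (p x0 y)%:E + w2%:E * (\int[Pt]_x (p x y `^ r^-1)%:E) `^ r)%E.
  rewrite integral_sparse; last 2 first.
  - exact: (measurable_fun_pair1 y mpow).
  - by move=> x; rewrite lee_fin powR_ge0.
  rewrite -/t.
  have : (0 <= \int[Pt]_x (p x y `^ r^-1)%:E)%E.
    by apply: integral_ge0 => x _; rewrite lee_fin powR_ge0.
  have pE : (p x0 y `^ r^-1) `^ r = p x0 y.
    by rewrite -powRrM mulVf ?gt_eqF// powRr1.
  case: (\int[Pt]_x (p x y `^ r^-1)%:E)%E => [v| |]//.
    rewrite lee_fin => v0; rewrite -!EFinM -!EFinD !poweR_EFin -?EFinM -?EFinD lee_fin.
    apply: (le_trans (powR_convex_scaled _ t01 A0 (powR_ge0 _ _) v0)) => //.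
    rewrite -/t -/S pE /w1 /w2 le_eqVlt; apply/orP; left; apply/eqP.
    by rewrite mulrDr !mulrA.
  (* Where the mixture over [Pt] is infinite, the right-hand side is infinite too unless tau = 0. *)
  move=> _; have [tau0|taun0] := eqVneq t 0.
    rewrite /w2 /w1 /S tau0 !mul0r !mulr0 !mul0e !adde0 subr0 mul1e addr0 powR1.
    by rewrite divr1 mulr1 mul1e poweR_EFin pE.
  have tpos : 0 < t by rewrite lt0r taun0.
  have w2_gt0 : 0 < w2 by rewrite mulr_gt0 ?powR_gt0// !divr_gt0 ?powR_gt0// mulr_gt0.
  rewrite [poweR +oo%E _]poweRyr ?gt_eqF// [(w2%:E * _)%E]gt0_muley ?lte_fin//.
  by rewrite addey// leey.
have mPt := measurable_gallager_integrand Pt.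
have [P PE] := sparse_probability tau x0 Pt.
apply: (@le_trans _ _ (\int[mu]_y
    (w1%:E * (p x0 y)%:E + w2%:E * (\int[Pt]_x (p x y `^ r^-1)%:E) `^ r))%E).
  apply: ge0_le_integral => //.
  - by move=> y _; exact: poweR_ge0.
  - by rewrite PE; exact: measurable_gallager_integrand.
  - apply: emeasurable_funD; apply: measurable_funeM => //.
    by apply/measurable_EFinP; exact: (measurable_channel_kernel chp).
have mp0 : measurable_fun [set: Y] (fun y => (p x0 y)%:E).
  by apply/measurable_EFinP; exact: (measurable_channel_kernel chp).
rewrite ge0_integralD//; last 4 first.
- by move=> y _; rewrite mule_ge0// lee_fin.
- exact: measurable_funeM.
- by move=> y _; rewrite mule_ge0 ?lee_fin ?poweR_ge0.
- exact: measurable_funeM.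
rewrite ge0_integralZl//; last by move=> y _; rewrite lee_fin.
rewrite ge0_integralZl//; last by move=> y _; exact: poweR_ge0.
rewrite p1 -/(gallager_integral Pt).
apply: (@le_trans _ _ (w1%:E * 1 + w2%:E * (A `^ r)%:E)%E).
  by rewrite leeD2l// lee_wpmul2l// lee_fin.
rewrite mule1 -EFinM -EFinD lee_fin le_eqVlt; apply/orP; left; apply/eqP.
have -> : w2 * A `^ r = S `^ r * (t * A / S).
  by rewrite /w2 -mulrA divfK// gt_eqF// powR_gt0.
by rewrite /w1 -mulrDr -mulrDl -/S divff ?mulr1// gt_eqF.
Qed.

End gallager_function.

(** * Existence of codes and optimal block length *)

Lemma random_code_exists dX dY (X : measurableType dX) (Y : measurableType dY)
    (R : realType) (mu : {sigma_finite_measure set Y -> \bar R}) (p : X -> Y -> R)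
    (P : probability X R) (n M : nat) (rho G eps : R) :
  channel mu p -> (0 < M)%N -> 0 < rho <= 1 ->
  gallager_integral mu p rho P = G%:E -> M.-1%:R `^ rho * G ^+ n < eps ->
  exists dec : decoding_rule X Y n M,
    [/\ measurable_rule dec, (average_error mu p P dec <= eps%:E)%E &
        exists c, (codebook_error mu p dec c <= eps%:E)%E].
Proof.
move=> chp M0 rho01 GE small.
have G0 : 0 <= G by rewrite -lee_fin -GE gallager_integral_ge0.
have [nuX InuX] := iter_int_measure n (integrates_self P).
have [nuC InuC] := iter_int_measure M InuX.
have [nuY InuY] := iter_int_measure n (integrates_self mu).
have [dec [mdec decmax]] := measurable_argmax M0
  (fun m : 'I_M => measurable_codeword_likelihood (n := n) chp m).
pose rule : decoding_rule X Y n M := fun c y => dec (c, y).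
have mrule : measurable_rule rule.
  move=> m; rewrite [X in measurable X](_ : _ = [set z | dec z = m])//.
  by apply/seteqP; split=> -[c y].
have ml c y m : likelihood p (tnth c m) y <= likelihood p (tnth c (rule c y)) y.
  exact: (decmax (c, y) m).
have bound := gallager_bound chp InuX InuC InuY mrule rho01 ml M0 G0 GE.
have avg : (average_error mu p P rule < eps%:E)%E.
  by apply: le_lt_trans bound _; rewrite lte_fin.
exists rule; split=> //; first exact: ltW.
exact: (codebook_exists chp InuX InuC InuY mrule avg).
Qed.

(** In 1 / sqrt t the bound is a quadratic with leading coefficient - b / rho, where b = log2(1 /
    edec). Positivity of [nstar] forces l > 0, as division by zero would give 0, and then b > 0,
    that is edec < 1. *)
Lemma sparse_rate_optimum (R : realType) (edet edec rho l nstar : R) :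
  0 < edet -> 0 < edec -> 0 < rho -> 0 <= l -> 0 < nstar ->
  Num.sqrt nstar = 2 * log2 edec^-1 / (edet * rho * l) ->
  [/\ forall t : R, 0 < t ->
        rate_bound edet edec rho l t <= rate_bound edet edec rho l nstar,
      rate_bound edet edec rho l nstar =
        edet ^+ 2 / (4 * log2 edec^-1) * rho * l ^+ 2 &
      nstar * rate_bound edet edec rho l nstar = rho^-1 * log2 edec^-1].
Proof.
move=> edet0 edec0 rho0 l0 nstar0 nstarE.
have log2V : log2 edec = - log2 edec^-1.
  by rewrite /log2 lnV ?posrE// mulNr opprK.
set b := log2 edec^-1 in nstarE log2V *.
have sqrt_gt0 : 0 < Num.sqrt nstar by rewrite sqrtr_gt0.
have l_gt0 : 0 < l.
  rewrite lt0r l0 andbT; apply/eqP => l_0.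
  by move: sqrt_gt0; rewrite nstarE l_0 mulr0 invr0 mulr0 ltxx.
have den_gt0 : 0 < edet * rho * l by rewrite !mulr_gt0.
have b_gt0 : 0 < b.
  by move: sqrt_gt0; rewrite nstarE pmulr_lgt0 ?invr_gt0// pmulr_rgt0.
have nstarV : nstar = (2 * b / (edet * rho * l)) ^+ 2.
  by rewrite -nstarE sqr_sqrtr// ltW.
have optimum : rate_bound edet edec rho l nstar =
    edet ^+ 2 / (4 * b) * rho * l ^+ 2.
  rewrite /rate_bound nstarE nstarV log2V; field.
  by rewrite !gt_eqF.
split=> //.
- move=> t t0; rewrite optimum /rate_bound log2V.
  have : 0 < Num.sqrt t by rewrite sqrtr_gt0.
  have : t = Num.sqrt t ^+ 2 by rewrite sqr_sqrtr// ltW.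
  move: (Num.sqrt t) => s -> s0; rewrite -subr_ge0.
  (* Completing the square: the gap to the optimum vanishes exactly at s = sqrt nstar. *)
  rewrite [leRHS](_ : _ = (edet * rho * l / 2 - b / s) ^+ 2 / (rho * b)).
    by rewrite divr_ge0 ?sqr_ge0// mulr_ge0// ltW.
  by field; rewrite !gt_eqF.
- rewrite optimum nstarV; field.
  by rewrite !gt_eqF.
Qed.

Lemma rate_boundE (R : realType) (edet edec rho l : R) (n : nat) : (0 < n)%N ->
  rate_bound edet edec rho l n%:R =
  n%:R^-1 * (edet * Num.sqrt n%:R * l + rho^-1 * log2 edec).
Proof.
move=> n0; have n0R : 0 < n%:R :> R by rewrite ltr0n.
have s0 : 0 < Num.sqrt n%:R :> R by rewrite sqrtr_gt0.
have sE : n%:R = Num.sqrt n%:R ^+ 2 :> R by rewrite sqr_sqrtr// ltW.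
rewrite /rate_bound mulrDr; congr (_ + _); last by rewrite invfM mulrA.
rewrite [X in _ = X^-1 * _]sE; field.
by rewrite gt_eqF.
Qed.

(** K <= M secures the rate, while M - 1 < K keeps the error small, since the random coding bound
    counts the M - 1 competitors of a word. *)
Lemma least_codebook_size (R : realType) (K : R) : 0 < K ->
  exists M : nat, [/\ (0 < M)%N, K <= M%:R & M.-1%:R < K].
Proof.
move=> K0.
have exM : exists M : nat, K <= M%:R.
  by exists (Num.bound K); exact/ltW/archi_boundP/ltW.
case: (ex_minnP exM) => M KM Mmin; have M0 : (0 < M)%N.
  by rewrite -(ltr0n R) (lt_le_trans K0).
exists M; split=> //; rewrite ltNge; apply/negP => /Mmin.
by rewrite leqNgt prednK// leqnn.
Qed.

(** Codes are constructed at the extreme tau, where the guarantee is attained. The optimum is over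
    real blocklengths, and the equality for k* concerns the guaranteed rate; an actual code at n =
    n* may carry more bits, whence the inequalities at the end. *)
Theorem corollary3 (R : realType) (dX dY dW : measure_display)
    (X : measurableType dX) (Y : measurableType dY) (W : measurableType dW)
    (muY : {sigma_finite_measure set Y -> \bar R})
    (muW : {sigma_finite_measure set W -> \bar R})
    (pYX : X -> Y -> R) (pWX : X -> W -> R) (x0 : X) (Pt : probability X R)
    (edet edec rho : R)
    (chY : channel muY pYX) (chW : channel muW pWX)
    (domW : forall tau : {i01 R},
      dominated (output (sparse tau x0 Pt) pWX) (pWX x0))
    (domY : forall tau : {i01 R},
      dominated (output (sparse tau x0 Pt) pYX) (pYX x0))
    (edet01 : 0 < edet < 1) (edec_gt0 : 0 < edec) (rho01 : 0 < rho <= 1) :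
  let L := gain muY muW pYX pWX x0 Pt edet rho in
  let bound := rate_bound edet edec rho L in
  [/\ (* existence of the codes, with the sparseness factor at its bound *)
      forall (n : nat) (tau : {i01 R}), (0 < n)%N ->
        tau%:num = tau_max muW pWX x0 Pt edet n ->
        exists (M : nat) (dec : decoding_rule X Y n M),
          [/\ (0 < M)%N,
              covert_code muY muW pYX pWX x0 edet edec (sparse tau x0 Pt) dec,
              exists c, (codebook_error muY pYX dec c <= edec%:E)%E,
              edet * Num.sqrt n%:R * L + rho^-1 * log2 edec <= log2 M%:R &
              bound n%:R <= rate R n M],
      (* the guaranteed rate, as a function of the blocklength *)
      forall nstar : R, 0 < nstar ->
        Num.sqrt nstar = 2 * log2 edec^-1 / (edet * rho * L) ->
        [/\ forall t : R, 0 < t -> bound t <= bound nstar,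
            bound nstar =
              edet ^+ 2 / (4 * log2 edec^-1) * rho * L ^+ 2 &
            nstar * bound nstar = rho^-1 * log2 edec^-1] &
      (* any code meeting the guarantee *)
      forall (n : nat) (tau : {i01 R}) (M : nat) (dec : decoding_rule X Y n M),
        (0 < n)%N -> (0 < M)%N ->
        tau%:num <= tau_max muW pWX x0 Pt edet n ->
        covert_code muY muW pYX pWX x0 edet edec (sparse tau x0 Pt) dec ->
        edet * Num.sqrt n%:R * L + rho^-1 * log2 edec <= log2 M%:R ->
        bound n%:R <= rate R n M /\
        (Num.sqrt n%:R = 2 * log2 edec^-1 / (edet * rho * L) ->
         edet ^+ 2 / (4 * log2 edec^-1) * rho * L ^+ 2 <= rate R n M /\
         rho^-1 * log2 edec^-1 <= n%:R * rate R n M)].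
Proof.
move=> L bound; have /andP[edet0 _] := edet01; have /andP[rho0 rho1] := rho01.
have ln2_gt0 : 0 < ln 2 :> R by rewrite ln_gt0// ltr1n.
set D := fine (chi2 muW (output Pt pWX) (pWX x0)).
set A := expR (- ((1 + rho)^-1 * gallagerE0 muY rho Pt pYX)).
have r0 : 0 < 1 + rho by rewrite addr_gt0.
have G_ge0 := gallager_integral_ge0 muY pYX rho Pt.
have G_le1 := gallager_integral_le1 chY rho0 Pt.
have G_fin : gallager_integral muY pYX rho Pt \is a fin_num.
  by rewrite ge0_fin_numE// (le_lt_trans G_le1)// ltry.
set G := fine (gallager_integral muY pYX rho Pt).
have GE : gallager_integral muY pYX rho Pt = G%:E by rewrite fineK.
have G0 : 0 <= G by exact: fine_ge0.
have G1 : G <= 1 by rewrite -lee_fin -GE.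
have AE : A = expR ((1 + rho)^-1 * ln G).
  by rewrite /A /gallagerE0 mulrN opprK.
have A_gt0 : 0 < A by exact: expR_gt0.
have A_le1 : A <= 1.
  by rewrite AE expR_le1 mulr_ge0_le0 ?invr_ge0 ?ln_le0// ltW.
(* Only an inequality is claimed: for G = 0 the convention ln 0 = 0 gives A = 1. *)
have GA : (gallager_integral muY pYX rho Pt <= (A `^ (1 + rho))%:E)%E.
  rewrite GE lee_fin AE -expRM mulrAC mulVf ?gt_eqF// mul1r.
  have [->|Gn0] := eqVneq G 0; first exact: expR_ge0.
  by rewrite lnK// posrE lt0r Gn0.
have LE : L = 2 * xi edet / ln 2 * ((1 + rho) / rho) * ((1 - A) / Num.sqrt D) by [].
have xi0 : 0 < xi edet by exact: expR_gt0.
have L_ge0 : 0 <= L.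
  by rewrite LE !mulr_ge0 ?invr_ge0 ?sqrtr_ge0 ?subr_ge0 ?(ltW rho0) ?(ltW r0)
    ?(ltW xi0) ?(ltW ln2_gt0).
have opt := sparse_rate_optimum edet0 edec_gt0 rho0 L_ge0.
have rate_ge (n M : nat) : (0 < n)%N ->
    edet * Num.sqrt n%:R * L + rho^-1 * log2 edec <= log2 M%:R ->
    bound n%:R <= rate R n M.
  by move=> n0 le; rewrite /bound rate_boundE// /rate ler_wpM2l.
split=> [n tau n0 tauE| |n tau M dec n0 M0 _ _ guarantee].
- pose T := edet * Num.sqrt n%:R * L + rho^-1 * log2 edec.
  have [M [M0 KM MK]] := least_codebook_size (expR_gt0 (T * ln 2)).
  have logM : T <= log2 M%:R.
    by rewrite /log2 ler_pdivlMr// -ler_expR lnK// posrE ltr0n.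
  have [P PE] := sparse_probability tau x0 Pt.
  have GP := gallager_integral_sparse chY rho0 x0 tau A_gt0 GA.
  have det := sparse_detection edet0 n0 chW (domW tau) tauE.
  rewrite {}PE in GP det *.
  have GPfin : gallager_integral muY pYX rho P \is a fin_num.
    by rewrite ge0_fin_numE ?gallager_integral_ge0// (le_lt_trans GP)// ltry.
  have GPE := esym (fineK GPfin); set g := fine _ in GPE.
  have g0 : 0 <= g by rewrite fine_ge0// gallager_integral_ge0.
  rewrite GPE lee_fin in GP.
  set S := 1 - _ + _ in GP.
  (* Here S = 1 - tau (1 - A) <= exp(- tau (1 - A)), which makes the exponent linear in tau. *)
  have gS : g <= expR (- (tau%:num * (1 - A) * (1 + rho))).
    apply: (le_trans GP); rewrite -mulNr expRM ge0_ler_powR ?(ltW r0) ?nnegrE ?expR_ge0//.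
      by rewrite /S addr_ge0 ?subr_ge0// mulr_ge0// ltW.
    by apply: le_trans (expR_ge1Dx _); rewrite /S le_eqVlt; apply/orP; left; apply/eqP; ring.
  (* This explains the form of L: at the extreme tau, 2^(rho edet sqrt n L) exactly balances the
     decay of the error bound. *)
  have exponent : ln 2 * rho * (edet * Num.sqrt n%:R * L) =
      n%:R * (tau%:num * (1 - A) * (1 + rho)).
    rewrite tauE /tau_max -/D LE sqrtrM ?ler0n// invfM.
    have s0 : 0 < Num.sqrt n%:R :> R by rewrite sqrtr_gt0 ltr0n.
    have sE : n%:R = Num.sqrt n%:R ^+ 2 :> R by rewrite sqr_sqrtr// ler0n.
    (* Keeping this inverse abstract covers D = 0, where it is 0. *)
    rewrite [X in _ = X * _]sE; move: ((Num.sqrt D)^-1) => i; field.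
    by rewrite !gt_eqF.
  have small : M.-1%:R `^ rho * g ^+ n < edec.
    (* By the choice of T, edec is exactly 2^(rho T) times the decay; the strict inequality comes
       from M - 1 < 2^T. *)
    have -> : edec = expR (T * ln 2) `^ rho *
        expR (- (n%:R * (tau%:num * (1 - A) * (1 + rho)))).
      rewrite -exponent -expRM -expRD -{1}[edec]lnK ?posrE//; congr expR.
      by rewrite /T /log2; field; rewrite !gt_eqF.
    apply: (@le_lt_trans _ _ (M.-1%:R `^ rho *
        expR (- (n%:R * (tau%:num * (1 - A) * (1 + rho)))))).
      rewrite ler_wpM2l ?powR_ge0// -mulrN expRM_natl.
      by apply: lerXn2r; rewrite ?nnegrE ?expR_ge0.
    by rewrite ltr_pM2r ?expR_gt0// gt0_ltr_powR ?nnegrE ?expR_ge0.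
  have [dec [mdec avg cb]] := random_code_exists chY M0 rho01 GPE small.
  exists M, dec; split=> //; exact: rate_ge.
- by move=> nstar nstar0 nstarE; exact: opt.
- have le := rate_ge _ _ n0 guarantee; split=> // nstarE.
  have n0R : 0 < n%:R :> R by rewrite ltr0n.
  have [_ boundE kE] := opt _ n0R nstarE.
  by split; [rewrite -boundE|rewrite -kE ler_pM2l].
Qed.
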